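(* Let $f$ be a holomorphic function in $\mathbb C$ which has real Taylor coefficients $a_k$ in the neighborhood of $z=0$. Then in any odd dimension $n>1$ the equality $$\tau_n[f](x)=\eta_n[f](x)$$ holds if and only if $f(z)$ is of the form $$\sum_{r=0}^{n-2}\frac{r!\,a_r z^r}{(n-1+r)!}\;{}_1F_{n-1}\left(1;\frac{n+r}{n-1},\frac{n+r+1}{n-1},\ldots,\frac{2n+r-2}{n-1};\frac{\gamma_n[f]\,z^{n-1}}{(n-1)^{n-1}}\right),$$ where ${}_1F_{n-1}$ is a generalized hypergeometric function and $\gamma_n[f]$ is an arbitrary real constant.
   Context: **Clifford algebra.** $C\ell(n)$ is the real Clifford algebra generated by an orthonormal basis $\mathbf e_1,\dots,\mathbf e_n$ of $\mathbb R^n$ with $\mathbf e_i\mathbf e_j+\mathbf e_j\mathbf e_i=-2\delta_{ij}$. A point $(x_0,\dots,x_n)\in\mathbb R^{n+1}$ is identified with the paravector $x=x_0+\mathbf x$, where $\mathbf x=x_1\mathbf e_1+\dots+x_n\mathbf e_n$; its conjugate is $\overline x=x_0-\mathbf x$. The variable $x$ in the claim is a paravector. A $C\ell(n)$-valued function on an open subset of $\mathbb R^{n+1}$ is $C\ell(n)$-holomorphic if it is annihilated by the generalized Cauchy-Riemann operator $\partial_{x_0}+\sum_{i=1}^n\mathbf e_i\partial_{x_i}$ (acting from the left). **Appell polynomials.** $P_k^n$ ($k\ge0$) is the $C\ell(n)$-holomorphic polynomial, homogeneous of degree $k$, of the form $$P^n_k(x)=\sum_{s=0}^k {}^nT^k_s\,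 x^{k-s}\,\overline{x}^{\,s},\qquad P^n_k(1)=1,$$ with real constants ${}^nT^k_s$, whose alternating sums are $$\sum_{s=0}^{k}(-1)^s\,{}^nT_s^k=\begin{cases}\dfrac{(k-1)!!\,(n-2)!!}{(n+k-2)!!}, & k \text{ even},\\[2mm] \dfrac{k!!\,(n-2)!!}{(n+k-1)!!}, & k\text{ odd},\end{cases}$$ with $(-1)!!=0!!=1$. **Appell extension.** For a function $f$ with real Taylor coefficients $a_k$ at $0$, $\eta_n[f](x)=\sum_{k=0}^\infty a_kP_k^n(x)$ in a neighborhood of the origin $x=0$. **Fueter-Sce transformation.** Let $n>1$ be odd and let $f(w+\mathrm i y)=u(w,y)+\mathrm i v(w,y)$ be holomorphic (for $y\ge 0$), with $u,v$ real valued. Put $\boldsymbol\omega(\mathbf x)=\mathbf x/|\mathbf x|$. Then $$\tau_n[f](x)=\alpha_n[f]\left(\left(\frac1{|\mathbf x|}\partial_{|\mathbf x|}\right)^{\frac{n-1}2}u(x_0,|\mathbf x|)+\boldsymbol\omega(\mathbf x)\left(\partial_{|\mathbf x|}\frac1{|\mathbf x|}\right)^{\frac{n-1}2}v(x_0,|\mathbf x|)\right),$$ where the constant $\alpha_n[f]$ is arbitrary (often used to preserve some property of $f$, such as a normalization at a certain point), and $\partial_{|\mathbf x|}\frac{1}{|\mathbf x|}$ means ''multiply by $1/|\mathbf x|$, then differentiate with respect to $|\mathbf x|$''. **Generalized hypergeometric function.** ${}_1F_{n-1}(1;b_1,\dots,b_{n-1};\zeta)=\sum_{l=0}^\infty \frac{(1)_l}{(b_1)_l\cdots(b_{n-1})_l}\frac{\zeta^l}{l!}=\sum_{l=0}^\infty\frac{\zeta^l}{(b_1)_l\cdots(b_{n-1})_l}$,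 where $(b)_l=\prod_{j=0}^{l-1}(b+j)$.
   Formalization: The printed form fails (n=3, f=exp: equality holds but the sum at 0 is 1/2). With S(z) the printed sum, the form proved is a_0+…+a_{n-2}z^{n-2}+γ z^{n-1}S(z), γ a nonzero real constant (γ=0 fails unless f=0); equality means for some real α_n[f]. *)

(* Defs.v *)
From HB Require Import structures.
From mathcomp Require Import all_boot all_order all_algebra ring.
Set Implicit Arguments.
Unset Strict Implicit.
Unset Printing Implicit Defensive.
Import Order.TTheory GRing.Theory Num.Theory.
Local Open Scope ring_scope.

(* The Clifford algebra Cl(n): the free R-module on the blades
   e_A = e_{i_1} ... e_{i_k}, A = {i_1 < ... < i_k}; an element is the family
   of its blade coordinates. The n generators e_1, ..., e_n are indexed by
   'I_n, i.e. from 0. *)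
Definition clifford (R : comNzRingType) (n : nat) : Type :=
  {ffun {set 'I_n} -> R^o}.

HB.instance Definition _ (R : comNzRingType) (n : nat) :=
  GRing.Lmodule.copy (clifford R n) {ffun {set 'I_n} -> R^o}.

Section Clifford.
Context {R : comNzRingType} {n : nat}.
Implicit Types (A B C : {set 'I_n}) (x y z : clifford R n).

Definition cl_coord x A : R := (x : {ffun {set 'I_n} -> R^o}) A.

Definition mk_clifford (f : {set 'I_n} -> R) : clifford R n :=
  [ffun A => f A : R^o].

Definition symdiff A B : {set 'I_n} := (A :\: B) :|: (B :\: A).

Definition blade A : clifford R n := mk_clifford (fun B => (B == A)%:R).

(* e_A e_B = blade_sign A B *: e_(symdiff A B): sorting the factors costs -1
   for each pair i in A, j in B with j < i, and each repeated generator
   contributes e_i ^ 2 = -1. *)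
Definition blade_sign A B : R :=
  \prod_(i in A) \prod_(j in B | (j <= i)%N) (-1).

Definition cl_mul x y : clifford R n :=
  \sum_A \sum_B
    (blade_sign A B * cl_coord x A * cl_coord y B) *: blade (symdiff A B).

Lemma cl_coordP x y : (forall A, cl_coord x A = cl_coord y A) -> x = y.
Proof. by move=> xy; apply/ffunP => A; apply: xy. Qed.

Lemma mk_cliffordE f A : cl_coord (mk_clifford f) A = f A.
Proof. by rewrite /cl_coord ffunE. Qed.

Lemma cl_coord0 A : cl_coord 0 A = 0. Proof. by rewrite /cl_coord ffunE. Qed.

Lemma cl_coordD x y A : cl_coord (x + y) A = cl_coord x A + cl_coord y A.
Proof. by rewrite /cl_coord ffunE. Qed.

Lemma cl_coordZ a x A : cl_coord (a *: x) A = a * cl_coord x A.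
Proof. by rewrite /cl_coord ffunE. Qed.

Lemma cl_coord_sum I (r : seq I) P (F : I -> clifford R n) A :
  cl_coord (\sum_(i <- r | P i) F i) A = \sum_(i <- r | P i) cl_coord (F i) A.
Proof.
exact: (big_morph (cl_coord^~ A) (fun x y => cl_coordD x y A) (cl_coord0 A)).
Qed.

Lemma blade_coord A B : cl_coord (blade A) B = (B == A)%:R.
Proof. exact: mk_cliffordE. Qed.

Lemma in_symdiff A B i : (i \in symdiff A B) = (i \in A) (+) (i \in B).
Proof. by rewrite !inE; do 2 case: (_ \in _). Qed.

Lemma symdiffA : associative symdiff.
Proof. by move=> A B C; apply/setP => i; rewrite !in_symdiff addbA. Qed.

Lemma symdiffC : commutative symdiff.
Proof. by move=> A B; apply/setP => i; rewrite !in_symdiff addbC. Qed.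

Lemma symdiffKl A B : symdiff A (symdiff A B) = B.
Proof. by apply/setP => i; rewrite !in_symdiff addKb. Qed.

Lemma symdiff0 A : symdiff set0 A = A.
Proof. by apply/setP => i; rewrite in_symdiff inE. Qed.

Lemma symdiff_eq A B C : (C == symdiff A B) = (B == symdiff A C).
Proof. by apply/eqP/eqP => ->; rewrite symdiffKl. Qed.

Lemma prod_symdiff (c : 'I_n -> R) A B : (forall i, c i * c i = 1) ->
  \prod_(i in symdiff A B) c i = (\prod_(i in A) c i) * \prod_(i in B) c i.
Proof.
move=> cc; rewrite [LHS]big_mkcond [in RHS]big_mkcond [X in _ * X]big_mkcond.
rewrite -big_split /=; apply: eq_bigr => i _; rewrite in_symdiff.
by do 2 case: (_ \in _); rewrite /= ?mul1r ?mulr1 ?cc.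
Qed.

Lemma blade_sign_symdiffl A B C :
  blade_sign (symdiff A B) C = blade_sign A C * blade_sign B C.
Proof.
apply: prod_symdiff => i; rewrite -big_split /=.
by apply: big1 => j _; rewrite mulrNN mulr1.
Qed.

Lemma blade_sign_symdiffr A B C :
  blade_sign A (symdiff B C) = blade_sign A B * blade_sign A C.
Proof.
rewrite /blade_sign -big_split /=; apply: eq_bigr => i _.
under eq_bigl do rewrite in_symdiff.
rewrite !big_mkcondr /=.
under eq_bigl do rewrite -in_symdiff.
by apply: prod_symdiff => j; case: ifP; rewrite ?mulrNN mulr1.
Qed.

Lemma cl_mulE x y C : cl_coord (cl_mul x y) C =
  \sum_A blade_sign A (symdiff A C) * cl_coord x A * cl_coord y (symdiff A C).
Proof.
rewrite cl_coord_sum; apply: eq_bigr => A _; rewrite cl_coord_sum.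
rewrite (bigD1 (symdiff A C)) //= big1 ?addr0 => [|B /negbTE neB].
  by rewrite cl_coordZ blade_coord symdiffKl eqxx mulr1.
by rewrite cl_coordZ blade_coord symdiff_eq neB mulr0.
Qed.

Fact cl_mulA : associative cl_mul.
Proof.
move=> x y z; apply: cl_coordP => D; rewrite !cl_mulE.
under eq_bigr => A _ do rewrite cl_mulE mulr_sumr.
under [RHS]eq_bigr => C _ do rewrite cl_mulE mulr_sumr mulr_suml.
rewrite [RHS]exchange_big /=; apply: eq_bigr => A _.
rewrite [RHS](reindex_inj (h := symdiff A)) /=; last first.
  by move=> B C /(congr1 (symdiff A)); rewrite !symdiffKl.
apply: eq_bigr => B _; rewrite !symdiffKl.
have -> : symdiff (symdiff A B) D = symdiff B (symdiff A D).
  by rewrite [symdiff A B]symdiffC symdiffA.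
rewrite blade_sign_symdiffl.
have -> : blade_sign A (symdiff A D) =
    blade_sign A B * blade_sign A (symdiff B (symdiff A D)).
  by rewrite -blade_sign_symdiffr symdiffKl.
ring.
Qed.

Fact cl_mul1l : left_id (blade set0) cl_mul.
Proof.
move=> x; apply: cl_coordP => C; rewrite cl_mulE (bigD1 set0) //= big1.
  by rewrite /blade_sign big_set0 blade_coord eqxx symdiff0 !mul1r addr0.
by move=> A /negbTE A0; rewrite blade_coord A0 mulr0 mul0r.
Qed.

Fact cl_mul1r : right_id (blade set0) cl_mul.
Proof.
move=> x; apply: cl_coordP => C; rewrite cl_mulE (bigD1 C) //= big1.
  have -> : symdiff C C = set0.
    by apply/setP => i; rewrite in_symdiff addbb inE.
  rewrite blade_coord eqxx mulr1 addr0 /blade_sign big1 ?mul1r // => i _.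
  by apply: big_pred0 => j; rewrite inE.
move=> A neA; rewrite blade_coord; case: eqP => [AC|]; last by rewrite mulr0.
by rewrite -(symdiffKl A C) AC symdiffC symdiff0 eqxx in neA.
Qed.

Fact cl_mulDl : left_distributive cl_mul +%R.
Proof.
move=> x y z; apply: cl_coordP => C; rewrite cl_coordD !cl_mulE -big_split /=.
by apply: eq_bigr => A _; rewrite cl_coordD mulrDr mulrDl.
Qed.

Fact cl_mulDr : right_distributive cl_mul +%R.
Proof.
move=> x y z; apply: cl_coordP => C; rewrite cl_coordD !cl_mulE -big_split /=.
by apply: eq_bigr => A _; rewrite cl_coordD mulrDr.
Qed.

Fact cl_one_neq0 : blade set0 != 0.
Proof.
apply/eqP => /(congr1 (cl_coord^~ set0)) /=; rewrite blade_coord cl_coord0 eqxx.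
exact/eqP/oner_neq0.
Qed.

Fact cl_scaleAl a x y : a *: cl_mul x y = cl_mul (a *: x) y.
Proof.
apply: cl_coordP => C; rewrite cl_coordZ !cl_mulE mulr_sumr.
by apply: eq_bigr => A _; rewrite cl_coordZ; ring.
Qed.

Fact cl_scaleAr a x y : a *: cl_mul x y = cl_mul x (a *: y).
Proof.
apply: cl_coordP => C; rewrite cl_coordZ !cl_mulE mulr_sumr.
by apply: eq_bigr => A _; rewrite cl_coordZ; ring.
Qed.

End Clifford.

HB.instance Definition _ (R : comNzRingType) (n : nat) :=
  GRing.Zmodule_isNzRing.Build (clifford R n) (@cl_mulA R n) (@cl_mul1l R n)
    (@cl_mul1r R n) (@cl_mulDl R n) (@cl_mulDr R n) (@cl_one_neq0 R n).
HB.instance Definition _ (R : comNzRingType) (n : nat) :=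
  GRing.Lmodule_isLalgebra.Build R (clifford R n) (@cl_scaleAl R n).
HB.instance Definition _ (R : comNzRingType) (n : nat) :=
  GRing.Lalgebra_isAlgebra.Build R (clifford R n) (@cl_scaleAr R n).

Definition gen {R : comNzRingType} {n : nat} (i : 'I_n) : clifford R n :=
  blade [set i].

Lemma blade_mul (R : comNzRingType) n (A B : {set 'I_n}) :
  blade A * blade B = blade_sign A B *: blade (symdiff A B) :> clifford R n.
Proof.
apply: cl_coordP => C; rewrite cl_mulE cl_coordZ (bigD1 A) //= big1; last first.
  by move=> A' /negbTE neA; rewrite [cl_coord (blade A) _]blade_coord neA mulr0 mul0r.
rewrite !blade_coord eqxx mulr1 addr0 (symdiff_eq A B C) [symdiff A C == B]eq_sym.
by case: eqP => [->|]; rewrite ?mulr0 // symdiffKl.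
Qed.

Lemma gen_anticomm (R : comNzRingType) n (i j : 'I_n) :
  gen i * gen j + gen j * gen i = - 2 * (i == j)%:R :> clifford R n.
Proof.
rewrite /gen !blade_mul [symdiff [set j] _]symdiffC -scalerDl /blade_sign.
have sgn1 (k l : 'I_n) : \prod_(i0 in [set k]) \prod_(j0 in [set l] | (j0 <= i0)%N)
    (-1) = (if (l <= k)%N then -1 else 1) :> R.
  rewrite big_set1; case: ifP => lk.
    rewrite (bigD1 l) /= ?inE ?eqxx // big1 ?mulr1 // => m.
    by rewrite inE => /andP[/andP[/eqP-> _]]; rewrite eqxx.
  rewrite big_pred0 // => m; rewrite inE; case: eqP => //= ->; exact: lk.
rewrite !sgn1; case: (eqVneq i j) => [->|neij].
  have -> : symdiff [set j] [set j] = set0.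
    by apply/setP => k; rewrite in_symdiff addbb inE.
  by rewrite leqnn mulr1 -opprD scaleNr scalerDl scale1r.
case: (ltngtP i j) => [_|_|/val_inj ij]; last by rewrite ij eqxx in neij.
- by rewrite subrr scale0r mulr0.
- by rewrite addNr scale0r mulr0.
Qed.

From mathcomp Require Import all_classical all_reals all_analysis.
From mathcomp Require Export complex.
Import numFieldNormedType.Exports.
Local Open Scope classical_set_scope.
Local Open Scope complex_scope.

Section Analytic.
Context {K : numFieldType}.

Definition entire (f : K -> K) : Prop := forall z, derivable f z 1.

Definition taylor_at0 (f : K -> K) (a : nat -> K) : Prop :=
  \forall z \near (0 : K), series (fun k => a k * z ^+ k) @ \oo --> f z.

Definition pochhammer (b : K) (l : nat) : K := \prod_(j < l) (b + j%:R).

(* The generalized hypergeometric function pFq, with upper parameters a and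
   lower parameters b. *)
Definition hypergeometric (a b : seq K) (z : K) : K :=
  limn (series (fun l =>
    (\prod_(c <- a) pochhammer c l) / (\prod_(c <- b) pochhammer c l)
    * (z ^+ l / l`!%:R))).

End Analytic.

(* k!!, with 0!! = 1; the value (-1)!! = 1 is obtained as 0.-1!!. *)
Fixpoint double_fact (k : nat) : nat :=
  if k is k'.+2 then (k * double_fact k')%N else 1%N.

Section FueterSce.
Context {R : realType} {n : nat}.
Implicit Types (x : 'rV[R]_n.+1) (T : nat -> nat -> R).

(* A point of R^(n+1) is a row vector; its entry of index 0 is x_0, and its
   entry of index lift ord0 i is the coordinate along gen i. *)
Definition scal x : R := x 0 ord0.
Definition vec x : clifford R n := \sum_(i < n) x 0 (lift ord0 i) *: gen i.
Definition vec_norm x : R := Num.sqrt (\sum_(i < n) x 0 (lift ord0 i) ^+ 2).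
Definition vec_dir x : clifford R n := (vec_norm x)^-1 *: vec x.

Definition paravector x : clifford R n := (scal x)%:A + vec x.
Definition paravector_conj x : clifford R n := (scal x)%:A - vec x.

Definition partial_clifford (g : 'rV[R]_n.+1 -> clifford R n) (i : 'I_n.+1) x :
    clifford R n :=
  mk_clifford (fun A => 'D_(delta_mx 0 i) (fun y => cl_coord (g y) A) x).

Definition cauchy_riemann (g : 'rV[R]_n.+1 -> clifford R n) x : clifford R n :=
  partial_clifford g ord0 x +
  \sum_(i < n) gen i * partial_clifford g (lift ord0 i) x.

Definition clifford_holomorphic (g : 'rV[R]_n.+1 -> clifford R n) : Prop :=
  forall x,
    (forall A, differentiable (fun y => cl_coord (g y) A) x) /\
    cauchy_riemann g x = 0.

Definition appell_poly T (k : nat) x : clifford R n :=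
  \sum_(s < k.+1) T k s *: (paravector x ^+ (k - s) * paravector_conj x ^+ s).

Definition appell_alternating_sum (k : nat) : R :=
  if odd k then
    (double_fact k * double_fact (n - 2))%:R / (double_fact (n + k - 1))%:R
  else
    (double_fact k.-1 * double_fact (n - 2))%:R / (double_fact (n + k - 2))%:R.

(* T k s is the coefficient of x ^ (k - s) * conj(x) ^ s in the k-th Appell
   polynomial; the values T k s with k < s are irrelevant. *)
Definition appell_family T : Prop := forall k,
  [/\ clifford_holomorphic (appell_poly T k),
      (forall x, paravector x = 1 -> appell_poly T k x = 1) &
      \sum_(s < k.+1) (-1) ^+ s * T k s = appell_alternating_sum k].

(* The series converges coordinatewise on the blades, which is convergence in
   the finite dimensional space Cl(n). *)
Definition appell_ext T (a : nat -> R) x : clifford R n :=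
  mk_clifford (fun A =>
    limn (series (fun k => a k * cl_coord (appell_poly T k x) A))).

(* The constant alpha is a parameter. The formula is meaningful for
   vec_norm x != 0, that is off the real axis. *)
Definition fueter_sce (alpha : R) (f : R[i] -> R[i]) x : clifford R n :=
  let u y := complex.Re (f (scal x +i* y)) in
  let v y := complex.Im (f (scal x +i* y)) in
  let m := n.-1./2 in
  let du := iter m (fun (g : R -> R) (r : R) => r^-1 * derive1 g r) u in
  let dv := iter m (fun (g : R -> R) => derive1 (fun r : R => r^-1 * g r)) v in
  alpha *: ((du (vec_norm x))%:A + dv (vec_norm x) *: vec_dir x).

End FueterSce.

(* Main.v *)
Require Import Defs.
From mathcomp Require Import all_boot all_order all_algebra.
From mathcomp Require Import all_classical all_reals all_analysis.
From mathcomp Require Import complex.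
From mathcomp Require Import ring lra zify.
Import Order.TTheory GRing.Theory Num.Theory.
Import numFieldNormedType.Exports Normc.
Local Open Scope classical_set_scope.
Local Open Scope ring_scope.
Local Open Scope complex_scope.
Set Implicit Arguments.
Unset Strict Implicit.
Unset Printing Implicit Defensive.

(* On a paravector x = s + v with |v|^2 = t, write (s + i y)^k = q_k(y^2) + i y w_k(y^2)
   and m = (n - 1) / 2.  Since (1/y d/dy) F(y^2) = 2 F'(y^2), tau_n[f](x) is
   alpha 2^m times the sum of the a_k (q_k^(m)(t) + w_k^(m)(t) v).  The Cauchy-Riemann
   equation and the normalisation determine the coefficients of P_k in the powers of s and v,
   and show that P_k is a constant multiple of q_(k+n-1)^(m)(t) + w_(k+n-1)^(m)(t) v.
   Hence tau_n[f] = eta_n[f] exactly when beta C(k+n-1, n-1) a_(k+n-1) = a_k for all k,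
   with beta = alpha 2^m (-1)^m m!, and summing the solutions of this recurrence residue by
   residue modulo n - 1 gives the hypergeometric form near 0.

   It holds on the whole plane because an entire function whose Taylor coefficients at 0 decay
   superexponentially is the sum of its Taylor series.  With trapezoidal sums along squares in
   place of contour integrals, Goursat's bisection gives |F(z0)| <= 2 sup |F| over an annulus
   around z0 for entire F, which is applied to the quotients (f(z) - S_k(z)) / z^k. *)

(** The conclusion concerns every z, while [taylor_at0] speaks of a neighbourhood of 0 and [entire]
    of derivability at each point; what bridges the gap is the recurrence itself, whose solutions
    satisfy |a_k| <= A G^k / k!. For the necessity, tau_n[f] = eta_n[f] is tested only at the points
    r e_1: there s = 0, P_k reduces to a nonzero multiple of r^k e_1^k, and one blade coordinate of
    the right parity turns the equality into a real power series that vanishes for small r > 0. The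
    radial derivatives are taken term by term on real polynomials in t = |v|^2, dominated by a
    geometric series of ratio 1/2 on slightly larger intervals. The polynomials q_k and w_k have
    degree below m for k < n - 1, so the first n - 1 coefficients of f are lost under the m
    derivatives; they are the free data of the recurrence, and gamma = (n - 1)! / beta. *)

(** * Real-valued modulus on [R[i]], squares, and bisection *)

Section ComplexPlane.
Context {R : realType}.
Implicit Types (z w p u : R[i]) (g h : R[i] -> R[i]).
Let C : numFieldType := R[i].

Lemma normc_ge0 z : 0 <= normc z.
Proof. by case: z => a b; apply: sqrtr_ge0. Qed.

Lemma normrc z : `|z| = (normc z)%:C.
Proof. by case: z => a b; rewrite normc_def. Qed.

Lemma normcB z w : normc (z - w) = normc (w - z).
Proof. by rewrite -normcN opprB. Qed.

Lemma normc_real (r : R) : normc r%:C = `|r|.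
Proof. by rewrite /= expr0n addr0 sqrtr_sqr. Qed.

Lemma normcX z k : normc (z ^+ k) = normc z ^+ k.
Proof. by elim: k => [|k IH]; rewrite ?normc1 // !exprS normcM IH. Qed.

Lemma normc_i : normc ('i : R[i]) = 1.
Proof. by rewrite /= expr0n add0r expr1n sqrtr1. Qed.

Lemma normc_gt0 z : (0 < normc z) = (z != 0).
Proof.
rewrite lt_neqAle normc_ge0 andbT eq_sym; apply/negP/negP.
  by move=> + /eqP z0; rewrite z0 normc0 eqxx.
by move=> + /eqP/eq0_normc z0; rewrite z0 eqxx.
Qed.

Lemma normc_sum I (r : seq I) (P : pred I) (F : I -> R[i]) :
  normc (\sum_(i <- r | P i) F i) <= \sum_(i <- r | P i) normc (F i).
Proof.
elim/big_rec2 : _ => [|i x y _ IH]; first by rewrite normc0.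
by rewrite (le_trans (le_normcD _ _)) // lerD2l.
Qed.

Lemma normcDr_le z w : normc z - normc w <= normc (z + w).
Proof. by rewrite lerBlDr -{1}(addrK w z) (le_trans (le_normcD _ _)) // normcN. Qed.

Lemma ler_Re z : `|complex.Re z| <= normc z.
Proof. by have := normc_ge_Re z; rewrite normrc lecR. Qed.

Lemma ler_Im z : `|complex.Im z| <= normc z.
Proof. by have := ler_Re (z * 'i); rewrite ReiNIm normrN normcM normc_i mulr1. Qed.

Lemma normc_ReIm z : normc z <= `|complex.Re z| + `|complex.Im z|.
Proof.
rewrite [z in leLHS]complexE (le_trans (le_normcD _ _)) // normcM normc_i mul1r.
by rewrite !normc_real.
Qed.

Lemma cvgc_normP (T : Type) (F : set_system T) (FF : Filter F) (u : T -> C) (z : C) :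
  u @ F --> z <-> forall e : R, 0 < e -> \forall t \near F, normc (u t - z) < e.
Proof.
split=> [/cvgrPdist_lt H e e0|H].
  have := H e%:C; rewrite ltcR => /(_ e0); apply: filterS => t.
  by rewrite distrC normrc ltcR.
apply/cvgrPdist_lt => -[e e']; rewrite ltcE /= => /andP[/eqP -> e0].
by apply: filterS (H e e0) => t; rewrite distrC normrc ltcR.
Qed.

(** Multiplied out, so that no quotient appears and [w = z] needs no exception; [e] and [d] are
    real, hence within reach of real linear arithmetic. *)
Definition cdiff g z := exists L, forall e : R, 0 < e -> exists2 d : R, 0 < d &
  forall w, normc (w - z) < d -> normc (g w - g z - L * (w - z)) <= e * normc (w - z).

Lemma near0_normcP (P : C -> Prop) :
  (\forall z \near (0 : C), P z) <-> exists2 d : R, 0 < d & forall z, normc z < d -> P z.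
Proof.
split=> [/nbhs_ballP[[d d']] /=|[d d0 H]].
  rewrite ltcE /= => /andP[/eqP -> d0] H; exists d => // z zd; apply: H.
  by rewrite /ball /= sub0r normrN normrc ltcR.
apply/nbhs_ballP; exists d%:C; first by rewrite /= ltcR.
by move=> z; rewrite /ball /= sub0r normrN normrc ltcR; apply: H.
Qed.

Lemma derivable_cdiff (g : C -> C) (z : C) : derivable g z 1 -> cdiff g z.
Proof.
move=> /cvg_ex[/= L /cvgc_normP H]; exists L => e e0.
have := H e e0; rewrite /dnbhs /= => /near0_normcP[d d0 {}H].
exists d => // w wd; have [->|wz] := eqVneq w z.
  by rewrite !subrr mulr0 subrr normc0 mulr0.
have wz0 : w - z != 0 by rewrite subr_eq0.
have {H} := H _ wd wz0; rewrite scaler1 subrK => /ltW.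
rewrite -(ler_pM2r (x := normc (w - z))) ?normc_gt0 // -normcM.
by rewrite mulrBl -[_ *: _]/(_ * _) mulrAC mulVf // mul1r.
Qed.

Lemma cdiff_bounded g z : cdiff g z -> exists2 d : R, 0 < d &
  exists B, forall w, normc (w - z) < d -> normc (g w - g z) <= B * normc (w - z).
Proof.
move=> [L /(_ 1 ltr01)[d d0 H]]; exists d => //; exists (1 + normc L) => w /H {}H.
rewrite mulrDl -normcM -[g w - g z](subrK (L * (w - z))).
by rewrite (le_trans (le_normcD _ _)) // lerD2r.
Qed.

(** The side [u] is any complex number: multiplying it by ['i] turns the square about its corner,
    which yields the four squares needed for Cauchy's formula. *)
Definition in_square p u z := exists s t : R,
  [/\ 0 <= s <= 1, 0 <= t <= 1 & z = p + (s%:C + 'i * t%:C) * u].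

Lemma in_square_sub p u (s0 t0 : R) z : s0 = 0 \/ s0 = 1 -> t0 = 0 \/ t0 = 1 ->
  in_square (p + (s0%:C + 'i * t0%:C) * (u / 2)) (u / 2) z -> in_square p u z.
Proof.
have n2 : (2 : R[i])^-1 = (2^-1 : R)%:C by rewrite fmorphV rmorph_nat.
move=> Hs Ht [s [t [s01 t01 ->]]]; exists ((s0 + s) / 2), ((t0 + t) / 2).
split; [by case: Hs => ->; lra | by case: Ht => ->; lra |].
by rewrite n2 !rmorphM !rmorphD /=; ring.
Qed.

Lemma in_square_dist p u z w : in_square p u z -> in_square p u w ->
  normc (w - z) <= 2 * normc u.
Proof.
move=> [s [t [hs ht ->]]] [s' [t' [hs' ht' ->]]].
have -> : p + (s'%:C + 'i * t'%:C) * u - (p + (s%:C + 'i * t%:C) * u) =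
    ((s' - s)%:C + 'i * (t' - t)%:C) * u by rewrite !rmorphB /=; ring.
rewrite normcM ler_wpM2r ?normc_ge0 // (le_trans (le_normcD _ _)) //.
rewrite normcM normc_i mul1r !normc_real.
have : `|s' - s| <= 1 by rewrite ler_norml; lra.
have : `|t' - t| <= 1 by rewrite ler_norml; lra.
lra.
Qed.

(* Cousin's principle, by bisection. *)
Lemma square_induction (P : R[i] -> R[i] -> Prop) p u :
  (forall p u, P p (u / 2) -> P (p + u / 2) (u / 2) ->
     P (p + 'i * (u / 2)) (u / 2) -> P (p + (1 + 'i) * (u / 2)) (u / 2) -> P p u) ->
  (forall z, in_square p u z -> exists2 d : R, 0 < d & forall p' u',
     in_square p' u' z -> normc u' < d -> P p' u') ->
  P p u.
Proof.
move=> Psplit Ploc; apply: contrapT => nP.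
pose h k : R := 2^-1 ^+ k.
have h_gt0 k : 0 < h k by rewrite exprn_gt0 // invr_gt0.
have hS k : h k = h k.+1 + h k.+1 by rewrite /h exprS; lra.
(* [x] locates the corner in the frame where the initial square is the unit square, and [h k] is the
   side after [k] bisections. *)
pose bad k (x : R * R) := ~ P (p + (x.1%:C + 'i * x.2%:C) * u) (u * (h k)%:C).
have step k (x : R * R) : {y : R * R | bad k x -> [/\ bad k.+1 y,
    y.1 = x.1 \/ y.1 = x.1 + h k.+1 & y.2 = x.2 \/ y.2 = x.2 + h k.+1]}.
  apply: cid; have [bx|] := pselect (bad k x); last by exists x.
  apply: contrapT => /forallNP H; apply: bx.
  have {}H (s t : R) : s = x.1 \/ s = x.1 + h k.+1 ->
      t = x.2 \/ t = x.2 + h k.+1 -> P (p + (s%:C + 'i * t%:C) * u) (u * (h k.+1)%:C).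
    move=> Hs Ht; have := H (s, t); move/not_implyP => [_].
    by apply: contra_notP => nPst; split.
  have hu : u * (h k)%:C / 2 = u * (h k.+1)%:C.
    by rewrite hS rmorphD /=; field.
  apply: Psplit; rewrite hu.
  - by apply: H; left.
  - have := H (x.1 + h k.+1) x.2 (or_intror erefl) (or_introl erefl).
    by rewrite rmorphD /=; congr (P _ _); ring.
  - have := H x.1 (x.2 + h k.+1) (or_introl erefl) (or_intror erefl).
    by rewrite rmorphD /=; congr (P _ _); ring.
  - have := H (x.1 + h k.+1) (x.2 + h k.+1) (or_intror erefl) (or_intror erefl).
    by rewrite !rmorphD /=; congr (P _ _); ring.
pose x := fix x k := if k is k'.+1 then sval (step k' (x k')) else (0 : R, 0 : R).
have xbad k : bad k (x k).
  elim: k => [|k IH]; last by case: (svalP (step k (x k)) IH).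
  by rewrite /bad /h /= expr0 mulr1 mulr0 addr0 mul0r addr0.
have xS k := svalP (step k (x k)) (xbad k).
(* [c k] increases while [c k + h k] decreases, so the supremum of the corners lies in every
   interval [[c k, c k + h k]]. *)
have lim (c : nat -> R) : c 0%N = 0 -> (forall k, c k.+1 = c k \/ c k.+1 = c k + h k.+1) ->
    exists2 s, 0 <= s <= 1 & forall k, c k <= s <= c k + h k.
  move=> c0 cS.
  have cU j k : (k <= j)%N -> c k <= c j <= c k + h k - h j.
    elim: j => [|j IH]; first by rewrite leqn0 => /eqP->; lra.
    rewrite leq_eqVlt => /predU1P[->|]; first by rewrite lexx /=; lra.
    rewrite ltnS => /IH; have := h_gt0 j.+1; have := hS j.
    by case: (cS j) => ->; lra.
  have cV j k : c j <= c k + h k.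
    have := h_gt0 j; have := h_gt0 k.
    case/orP: (leq_total k j) => /cU; lra.
  have ubc k : ubound (range c) (c k + h k) by move=> _ [j _ <-].
  have sc : has_sup (range c) by split; [exists (c 0%N), 0%N|exists (c 0%N + h 0%N)].
  have H k : c k <= sup (range c) <= c k + h k.
    apply/andP; split; first by apply: sup_ubound; [case: sc|exists k].
    by apply: ge_sup; [case: sc|apply: ubc].
  exists (sup (range c)) => //; have := H 0%N.
  by rewrite c0 /h expr0 add0r.
have [s s01 Hs] := lim (fst \o x) erefl (fun k => let: And3 _ H _ := xS k in H).
have [t t01 Ht] := lim (snd \o x) erefl (fun k => let: And3 _ _ H := xS k in H).
(* The local hypothesis at the point common to all the bad squares contradicts badness once the side
   is below [d]. *)
have [|d d0 H] := Ploc (p + (s%:C + 'i * t%:C) * u); first by exists s, t.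
have [k hk] : exists k, normc u * h k < d.
  have : normc u * h k @[k --> \oo] --> normc u * 0.
    by apply: cvgMr; rewrite /h; apply: cvg_expr; rewrite ger0_norm; lra.
  rewrite mulr0 => /cvgrPdist_lt/(_ d d0)/filter_ex[k].
  rewrite sub0r normrN ger0_norm; first by exists k.
  by rewrite mulr_ge0 ?normc_ge0 // ltW.
apply: (xbad k); apply: H; last by rewrite normcM normc_real gtr0_norm.
exists ((s - (x k).1) / h k), ((t - (x k).2) / h k); split.
- have := Hs k; rewrite ler_pdivrMr // ler_pdivlMr //=; lra.
- have := Ht k; rewrite ler_pdivrMr // ler_pdivlMr //=; lra.
- have hn0 : (h k)%:C != 0 by rewrite fmorph_eq0; apply: lt0r_neq0.
  by rewrite !rmorphM !fmorphV !rmorphB /=; field.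
Qed.

(** Compactness of the square, obtained from the bisection principle. *)
Lemma bounded_on_square g p u :
  (forall z, in_square p u z -> exists2 d : R, 0 < d &
     exists B, forall w, normc (w - z) < d -> normc (g w) <= B) ->
  exists B, forall z, in_square p u z -> normc (g z) <= B.
Proof.
move=> H.
suff [B HB] : exists B, forall s t : R, 0 <= s <= 1 -> 0 <= t <= 1 ->
    normc (g (p + (s%:C + 'i * t%:C) * u)) <= B.
  by exists B => _ [s [t [hs ht ->]]]; apply: HB.
pose P p u := exists B, forall s t : R, 0 <= s <= 1 -> 0 <= t <= 1 ->
    normc (g (p + (s%:C + 'i * t%:C) * u)) <= B.
apply: (@square_induction P p u) => [q v [B1 H1] [B2 H2] [B3 H3] [B4 H4]|z /H[d d0 [B HB]]].
  exists (Num.max (Num.max B1 B2) (Num.max B3 B4)) => s t hs ht.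
  rewrite !le_max.
  have E (s0 t0 s' t' : R) : s = (s0 + s') / 2 -> t = (t0 + t') / 2 ->
      q + (s%:C + 'i * t%:C) * v =
      q + (s0%:C + 'i * t0%:C) * (v / 2) + (s'%:C + 'i * t'%:C) * (v / 2).
    by move=> -> ->; rewrite !fmorph_div !rmorph_nat !rmorphD /=; field.
  have [s2|s2] := leP s 2^-1; have [t2|t2] := leP t 2^-1.
  - rewrite (E 0 0 (2 * s) (2 * t)); [|lra|lra].
    by rewrite rmorph0 mulr0 addr0 mul0r addr0 H1 //; lra.
  - rewrite (E 0 1 (2 * s) (2 * t - 1)); [|lra|lra].
    by rewrite rmorph0 rmorph1 mulr1 add0r H3 ?orbT //; lra.
  - rewrite (E 1 0 (2 * s - 1) (2 * t)); [|lra|lra].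
    by rewrite rmorph0 rmorph1 mulr0 addr0 mul1r H2 ?orbT //; lra.
  - rewrite (E 1 1 (2 * s - 1) (2 * t - 1)); [|lra|lra].
    by rewrite rmorph1 mulr1 H4 ?orbT //; lra.
(* Half the radius, since [in_square_dist] bounds distances by twice the side. *)
exists (d / 2) => [|p' u' zin ud]; first lra.
exists B => s t hs ht; apply: HB.
have /(in_square_dist zin) H' : in_square p' u' (p' + (s%:C + 'i * t%:C) * u').
  by exists s, t.
by apply: le_lt_trans H' _; lra.
Qed.

End ComplexPlane.

(** * Trapezoidal sums and Goursat's theorem *)

Section Goursat.
Context {R : realType}.
Implicit Types (z w p q u : R[i]) (g h : R[i] -> R[i]).

(* The trapezoidal sum with [2 ^ n] steps for the integral of [g] along the segment [p, q]. *)
Fixpoint edge_sum g (n : nat) p q : R[i] :=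
  if n is n'.+1 then edge_sum g n' p ((p + q) / 2) + edge_sum g n' ((p + q) / 2) q
  else (g p + g q) / 2 * (q - p).

Lemma edge_sum_rev g n p q : edge_sum g n q p = - edge_sum g n p q.
Proof.
elim: n p q => [|n IH] p q /=; first by field.
by rewrite (addrC q p) (IH _ q) (IH p) opprD; exact: addrC.
Qed.

Lemma half_segment p q (t : R) :
  p + t%:C * ((p + q) / 2 - p) = p + (t / 2)%:C * (q - p).
Proof. by rewrite fmorph_div rmorph_nat /=; field. Qed.

Lemma half_segment' p q (t : R) :
  (p + q) / 2 + t%:C * (q - (p + q) / 2) = p + ((1 + t) / 2)%:C * (q - p).
Proof. by rewrite fmorph_div rmorph_nat rmorphD rmorph1 /=; field. Qed.

(** Exact at every [n]: trapezoids average values of [g], and the lengths of the steps add up to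
    [normc (q - p)]. *)
Lemma edge_sum_le g n p q B :
  (forall t : R, 0 <= t <= 1 -> normc (g (p + t%:C * (q - p))) <= B) ->
  normc (edge_sum g n p q) <= B * normc (q - p).
Proof.
elim: n p q => [|n IH] p q H /=.
  rewrite normcM ler_wpM2r ?normc_ge0 // normcM normcV.
  have -> : normc (2 : R[i]) = 2 by rewrite -(rmorph_nat (real_complex R)) normc_real normr_nat.
  have := H 0; have := H 1; rewrite !lexx ler01 rmorph0 mul0r addr0 rmorph1 mul1r subrKC.
  move=> /(_ isT) h1 /(_ isT) h0; rewrite ler_pdivrMr //.
  by rewrite (le_trans (le_normcD _ _)) // mulr_natr mulr2n lerD.
rewrite (le_trans (le_normcD _ _)) //.
have E1 : normc ((p + q) / 2 - p) = normc (q - p) / 2.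
  have -> : (p + q) / 2 - p = (q - p) * (2^-1)%:C by rewrite fmorphV rmorph_nat; field.
  by rewrite normcM normc_real ger0_norm.
have E2 : normc (q - (p + q) / 2) = normc (q - p) / 2.
  have -> : q - (p + q) / 2 = (q - p) * (2^-1)%:C by rewrite fmorphV rmorph_nat; field.
  by rewrite normcM normc_real ger0_norm.
have -> : B * normc (q - p) = B * (normc (q - p) / 2) + B * (normc (q - p) / 2) by field.
apply: lerD.
  by rewrite -{1}E1; apply: IH => t ht; rewrite half_segment H //; lra.
by rewrite -E2; apply: IH => t ht; rewrite half_segment' H //; lra.
Qed.

(** Serves to keep the sums of 1 / (z - z0) around [z0] away from 0 without computing an
    integral. *)
Lemma edge_sum_Im g n p q (c : R) :
  (forall t : R, 0 <= t <= 1 -> c <= complex.Im (g (p + t%:C * (q - p)) * (q - p))) ->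
  c <= complex.Im (edge_sum g n p q).
Proof.
elim: n p q c => [|n IH] p q c H /=.
  have := H 0; have := H 1; rewrite !lexx ler01 rmorph0 mul0r addr0 rmorph1 mul1r subrKC.
  move=> /(_ isT) h1 /(_ isT) h0.
  have -> : (g p + g q) / 2 * (q - p) = (2^-1)%:C * (g p * (q - p) + g q * (q - p)).
    by rewrite fmorphV rmorph_nat; ring.
  move: h1 h0; case: (g p * _) => a b; case: (g q * _) => a' b' /=; lra.
have ImD z w : complex.Im (z + w) = complex.Im z + complex.Im w by case: z w => ? ? [].
have Imh z : complex.Im (z / 2) = complex.Im z / 2.
  rewrite -(rmorph_nat (real_complex R)) -fmorphV; case: z => a b /=; ring.
rewrite ImD; have -> : c = c / 2 + c / 2 by field.
rewrite lerD // IH // => t ht.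
  rewrite half_segment (_ : (p + q) / 2 - p = (q - p) / 2); last by field.
  by rewrite mulrA Imh ler_pM2r ?invr_gt0 // H //; lra.
rewrite half_segment' (_ : q - (p + q) / 2 = (q - p) / 2); last by field.
by rewrite mulrA Imh ler_pM2r ?invr_gt0 // H //; lra.
Qed.

Lemma edge_sum_linear g h (c : R[i]) n p q :
  edge_sum (fun z => g z + c * h z) n p q = edge_sum g n p q + c * edge_sum h n p q.
Proof. by elim: n p q => [|n IH] p q /=; rewrite ?IH; ring. Qed.

(** The trapezoidal rule is exact on affine functions, so the linear approximation of a function can
    be subtracted at every level [n] without error. *)
Lemma edge_sum_affine (a b : R[i]) n p q :
  edge_sum (fun z => a + b * z) n p q = (a + b * ((p + q) / 2)) * (q - p).
Proof. by elim: n p q => [|n IH] p q /=; rewrite ?IH; field. Qed.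

Lemma normcD4_le (x y z w : R[i]) (a b c d : R) :
  normc x <= a -> normc y <= b -> normc z <= c -> normc w <= d ->
  normc (x + y + z + w) <= a + b + c + d.
Proof.
move=> xa yb zc wd; rewrite (le_trans (le_normcD _ _)) ?lerD //.
by rewrite (le_trans (le_normcD _ _)) ?lerD // (le_trans (le_normcD _ _)) ?lerD.
Qed.

(* The square with corner [p] and sides [u], ['i * u], run counterclockwise. *)
Definition square_sum g n p u : R[i] :=
  edge_sum g n p (p + u) + edge_sum g n (p + u) (p + u + 'i * u)
  + edge_sum g n (p + u + 'i * u) (p + 'i * u) + edge_sum g n (p + 'i * u) p.

(** Inner edges are run twice in opposite directions. One level of refinement is consumed because
    the midpoints of the sides are corners of the smaller squares. *)
Lemma square_sum_split g n p u : square_sum g n.+1 p u =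
  square_sum g n p (u / 2) + square_sum g n (p + u / 2) (u / 2)
  + square_sum g n (p + 'i * (u / 2)) (u / 2)
  + square_sum g n (p + (1 + 'i) * (u / 2)) (u / 2).
Proof.
rewrite /square_sum /=; set v := u / 2.
have -> : u = v + v by rewrite /v; field.
set p01 := p + 'i * v; set p10 := p + v; set p11 := p + v + 'i * v.
set p20 := p + (v + v); set p02 := p + 'i * (v + v).
set p21 := p + (v + v) + 'i * v; set p12 := p + v + 'i * (v + v).
set p22 := p + (v + v) + 'i * (v + v).
have -> : (p + p20) / 2 = p10 by rewrite /p20 /p10; field.
have -> : (p20 + p22) / 2 = p21 by rewrite /p20 /p22 /p21; field.
have -> : (p22 + p02) / 2 = p12 by rewrite /p22 /p02 /p12; field.
have -> : (p02 + p) / 2 = p01 by rewrite /p02 /p01; field.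
have -> : p10 + v = p20 by rewrite /p10 /p20 addrA.
have -> : p20 + 'i * v = p21 by [].

have -> : p01 + v = p11 by rewrite /p01 /p11; ring.
have E : p11 + 'i * v = p12 by rewrite /p11 /p12; ring.
have -> : p01 + 'i * v = p02 by rewrite /p01 /p02; ring.
have -> : p + (1 + 'i) * v = p11 by rewrite /p11; ring.
have -> : p11 + v = p21 by rewrite /p11 /p21; ring.
have -> : p21 + 'i * v = p22 by rewrite /p21 /p22; ring.
rewrite !{}E (edge_sum_rev g n p10 p11) (edge_sum_rev g n p01 p11).
rewrite (edge_sum_rev g n p11 p12) (edge_sum_rev g n p11 p21).
ring.
Qed.

Lemma square_sum_le g n p u B : (forall z, in_square p u z -> normc (g z) <= B) ->
  normc (square_sum g n p u) <= 4 * B * normc u.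
Proof.
move=> H; have edgeP q0 q1 : normc (q1 - q0) = normc u ->
    (forall t : R, 0 <= t <= 1 -> normc (g (q0 + t%:C * (q1 - q0))) <= B) ->
    normc (edge_sum g n q0 q1) <= B * normc u by move=> <-; apply: edge_sum_le.
have -> : 4 * B * normc u = B * normc u + B * normc u + B * normc u + B * normc u by ring.
have niu : normc ('i * u) = normc u by rewrite normcM normc_i mul1r.
have O1 : 0 <= (0 : R) <= 1 by rewrite lexx ler01.
have O2 : 0 <= (1 : R) <= 1 by rewrite lexx ler01.
apply: normcD4_le.
- apply: edgeP; first by congr normc; ring.
  move=> t ht; apply: H; exists t, 0; split => //.
  by rewrite rmorph0; ring.
- apply: edgeP; first by rewrite -[RHS]niu; congr normc; ring.
  move=> t ht; apply: H; exists 1, t; split => //.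
  by rewrite rmorph1; ring.
- apply: edgeP; first by rewrite normcB; congr normc; ring.
  move=> t ht; apply: H; exists (1 - t), 1; split => //; first lra.
  by rewrite rmorphB rmorph1; ring.
- apply: edgeP; first by rewrite normcB -[RHS]niu; congr normc; ring.
  move=> t ht; apply: H; exists 0, (1 - t); split => //; first lra.
  by rewrite rmorphB rmorph0 rmorph1; ring.
Qed.

Lemma square_sum_affine (a b : R[i]) n p u :
  square_sum (fun z => a + b * z) n p u = 0.
Proof. by rewrite /square_sum !edge_sum_affine; field. Qed.

Lemma square_sum_linear g h (c : R[i]) n p u :
  square_sum (fun z => g z + c * h z) n p u = square_sum g n p u + c * square_sum h n p u.
Proof. by rewrite /square_sum !edge_sum_linear; ring. Qed.

(** Takes the place of a bound on the contour integral; the sums need not be known to converge. *)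
Definition small_sums g p u (e : R) :=
  \forall n \near \oo, normc (square_sum g n p u) <= e.

Lemma small_sums_split g p u (a b c d : R) :
  small_sums g p (u / 2) a -> small_sums g (p + u / 2) (u / 2) b ->
  small_sums g (p + 'i * (u / 2)) (u / 2) c ->
  small_sums g (p + (1 + 'i) * (u / 2)) (u / 2) d ->
  small_sums g p u (a + b + c + d).
Proof.
move=> Ha Hb Hc Hd.
suff [N _ H] : \forall n \near \oo, normc (square_sum g n.+1 p u) <= a + b + c + d.
  by exists N.+1 => // -[//|n] Nn; apply: H.
near=> n; rewrite square_sum_split.
by apply: normcD4_le; near: n.
Unshelve. all: by end_near. Qed.

(** A bound proportional to [normc u ^+ 2] is additive under quartering, as the quarters have the
    same total area, so it passes from the quarters to the square. *)
Lemma goursat g p u e : 0 < e -> (forall z, in_square p u z -> cdiff g z) ->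
  small_sums g p u e.
Proof.
(* The summand 1 keeps the denominator positive when [u = 0]. *)
move=> e0 gd; pose eta := e / (1 + normc u ^+ 2).
have u0 := normc_ge0 u.
have d0 : 0 < 1 + normc u ^+ 2 by rewrite ltr_wpDr ?exprn_ge0.
have eta0 : 0 < eta by rewrite divr_gt0.
suff : small_sums g p u (eta * normc u ^+ 2).
  apply: filterS => n /le_trans; apply.
  by rewrite /eta mulrAC ler_pdivrMr // ler_pM2l // lerDr ler01.
pose P p u := small_sums g p u (eta * normc u ^+ 2).
(* The 8 accounts for the four sides and for the factor 2 of [in_square_dist]. *)
apply: (@square_induction _ P p u) => [q v h1 h2 h3 h4|z /gd [L /(_ (eta / 8))[|d dp H]]].
- rewrite /P.
  have -> : eta * normc v ^+ 2 = eta * normc (v / 2) ^+ 2 + eta * normc (v / 2) ^+ 2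
      + eta * normc (v / 2) ^+ 2 + eta * normc (v / 2) ^+ 2.
    by rewrite normcM normcV -(rmorph_nat (real_complex R)) normc_real normr_nat; field.
  exact: small_sums_split.
- by rewrite divr_gt0.
exists (d / 2) => [|q v zin vd]; first by rewrite divr_gt0.
near=> n.
(* Subtracting the affine approximation of [g] at [z] leaves the sum unchanged. *)
have -> : square_sum g n q v = square_sum (fun w => g w + (-1) * ((g z - L * z) + L * w)) n q v.
  by rewrite square_sum_linear square_sum_affine mulr0 addr0.
have -> : eta * normc v ^+ 2 = 4 * (eta / 8 * (2 * normc v)) * normc v by field.
apply: square_sum_le => w win.
have wz := in_square_dist zin win.
have -> : g w + -1 * (g z - L * z + L * w) = g w - g z - L * (w - z) by ring.
rewrite (le_trans (H w _)) ?ler_pM2l ?divr_gt0 //.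
by apply: le_lt_trans wz _; lra.
Unshelve. all: by end_near. Qed.

(** A bounded singularity at the corner is harmless: repeated quartering confines it to a square of
    side [u / 2 ^+ k], whose sum tends to 0 with its side, and [goursat] applies to all the other
    quarters. *)
Lemma goursat_corner g p u e B : 0 < e -> u != 0 ->
  (forall z, in_square p u z -> z != p -> cdiff g z) ->
  (forall z, in_square p u z -> normc (g z) <= B) ->
  small_sums g p u e.
Proof.
move=> e0 u0 gd gB.
have shrink k a d v : 0 < d -> v != 0 -> (forall z, in_square p v z -> z != p -> cdiff g z) ->
    small_sums g p (v / 2 ^+ k) a -> small_sums g p v (a + d).
  elim: k d v => [|k IH] d v d0 v0 vd; rewrite ?expr0 ?divr1.
    by apply: filterS => n /le_trans; apply; rewrite lerDl ltW.
  rewrite exprS invfM mulrA => Hk.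
  have -> : a + d = a + d / 4 + d / 4 + d / 4 + d / 4 by field.
  have d4 : 0 < d / 4 by rewrite divr_gt0.
  have vs (s0 t0 : R) z : s0 = 0 \/ s0 = 1 -> t0 = 0 \/ t0 = 1 ->
      in_square (p + (s0%:C + 'i * t0%:C) * (v / 2)) (v / 2) z -> in_square p v z.
    exact: in_square_sub.
  (* A quarter not starting at [p] avoids [p], because [s0 + s] and [t0 + t] cannot both vanish. *)
  have zp (s0 t0 : R) z : 0 < s0 + t0 -> 0 <= s0 -> 0 <= t0 ->
      in_square (p + (s0%:C + 'i * t0%:C) * (v / 2)) (v / 2) z -> z != p.
    move=> st s00 t00 [s [t [hs ht ->]]].
    have -> : p + (s0%:C + 'i * t0%:C) * (v / 2) + (s%:C + 'i * t%:C) * (v / 2)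
        = p + ((s0 + s)%:C + 'i * (t0 + t)%:C) * (v / 2) by rewrite !rmorphD /=; ring.
    have v2 : v / 2 != 0 by rewrite mulf_neq0 ?invr_eq0 ?pnatr_eq0.
    rewrite -subr_eq0 addrC addKr mulf_neq0 //.
    apply/negP => /eqP /(congr1 (fun z => complex.Re z + complex.Im z)) /=; lra.
  have sq (s0 t0 : R) : 0 < s0 + t0 -> s0 = 0 \/ s0 = 1 -> t0 = 0 \/ t0 = 1 ->
      small_sums g (p + (s0%:C + 'i * t0%:C) * (v / 2)) (v / 2) (d / 4).
    move=> st Hs Ht; apply: goursat => // z zin; apply: vd; first exact: vs zin.
    apply: zp zin => //; lra.
  apply: small_sums_split.
  - apply: IH => //.
      by rewrite mulf_neq0 // invr_eq0 pnatr_eq0.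
    move=> z zin; apply: vd; apply: (vs 0 0); [by left | by left |].
    by rewrite rmorph0 mulr0 addr0 mul0r addr0.
  - have := sq 1 0 ltac:(lra) (or_intror erefl) (or_introl erefl).
    by rewrite rmorph0 rmorph1 mulr0 addr0 mul1r.
  - have := sq 0 1 ltac:(lra) (or_introl erefl) (or_intror erefl).
    by rewrite rmorph0 rmorph1 mulr1 add0r.
  - have := sq 1 1 ltac:(lra) (or_intror erefl) (or_intror erefl).
    by rewrite rmorph1 mulr1.
have B0 : 0 <= B.
  apply: le_trans (normc_ge0 (g p)) (gB _ _); exists 0, 0.
  by rewrite lexx ler01; split=> //; rewrite rmorph0; ring.
have nu0 : 0 <= 4 * B * normc u by rewrite mulr_ge0 ?normc_ge0 // mulr_ge0.
have [k hk] : exists k, 4 * B * normc u * 2^-1 ^+ k < e / 2.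
  have : 4 * B * normc u * 2^-1 ^+ k @[k --> \oo] --> 4 * B * normc u * 0.
    by apply: cvgMr; apply: cvg_expr; rewrite ger0_norm; lra.
  rewrite mulr0 => /cvgrPdist_lt/(_ (e / 2))[|k _ /(_ k (leqnn k))]; first lra.
  rewrite sub0r normrN ger0_norm; first by exists k.
  by rewrite mulr_ge0 // exprn_ge0.
have -> : e = e / 2 + e / 2 by field.
apply: (shrink k) => //; first lra.
near=> n.
have uk : normc (u / 2 ^+ k) = normc u * 2^-1 ^+ k.
  by rewrite normcM normcV normcX -(rmorph_nat (real_complex R)) normc_real normr_nat exprVn.
rewrite (le_trans _ (ltW hk)) // -mulrA -uk; apply: square_sum_le => z [s [t [hs ht ->]]].
have k2 : 0 < (2^-1 : R) ^+ k <= 1.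
  by rewrite exprn_gt0 ?invr_gt0 // exprn_ile1 ?invr_ge0 //; lra.
apply: gB; exists (s * 2^-1 ^+ k), (t * 2^-1 ^+ k); split.
- by rewrite mulr_ge0 /= ?mulr_ile1 //; lra.
- by rewrite mulr_ge0 /= ?mulr_ile1 //; lra.
rewrite !rmorphM rmorphXn fmorphV rmorph_nat exprVn /=; ring.
Unshelve. all: by end_near. Qed.

End Goursat.

(** * Derivability of difference quotients and of Taylor quotients *)

Section DerivableQuotients.
Context {K : numFieldType}.

(** The quotient (F z - F z0) / (z - z0) is written in the shape [g z + c * h z] of
    [edge_sum_linear], which later separates its two terms. *)
Lemma derivable_difference_quotient (F : K -> K) (z0 z : K) :
  (forall z, derivable F z 1) -> z != z0 ->
  derivable (fun z => F z * (z - z0)^-1 + (- F z0) * (z - z0)^-1) z 1.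
Proof.
move=> Fd zz0.
have dV : derivable (fun w => (w - z0)^-1) z 1.
  apply: derivableV; first by rewrite subr_eq0.
  by apply: derivableB; [apply: derivable_id|apply: derivable_cst].
apply: derivableD; apply: derivableM => //; exact: derivable_cst.
Qed.

Lemma derivable_taylor_quotient (F : K -> K) (c : nat -> K) n (b z : K) :
  (forall z, derivable F z 1) -> z != 0 ->
  derivable (fun z => if z == 0 then b else
    (F z - series (fun k => c k * z ^+ k) n) / z ^+ n) z 1.
Proof.
move=> Fd z0; apply: (@near_eq_derivable _ _ _
    (fun z => (F z - series (fun k => c k * z ^+ k) n) / z ^+ n)).
  have : \forall w \near z, w != 0 by exact: (@cvgr_neq0 K K K (nbhs z) _ id z (@cvg_id _ _) z0).
  by apply: filterS => w /negbTE ->.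
have sumE : (\sum_(k < n) (fun z : K => c k * z ^+ k)) =
    (fun z => series (fun k => c k * z ^+ k) n).
  by apply/funext => w; rewrite /series /= big_mkord fct_sumE.
have : derivable (\sum_(k < n) (fun z : K => c k * z ^+ k)) z 1.
  apply: derivable_sum => k.
  exact: (derivableM (@derivable_cst K K K (c k) z 1) (@exprn_derivable K k z 1)).
rewrite sumE => dS.
have dV := @derivableV K K (fun w : K => w ^+ n) z 1 (expf_neq0 n z0) (@exprn_derivable K n z 1).
exact: (derivableM (derivableB (Fd z) dS) dV).
Qed.

End DerivableQuotients.

(** * From the Taylor series near 0 to the whole plane *)

Section EntireTaylor.
Context {R : realType}.
Let C : numFieldType := R[i].
Implicit Types (z w u v : R[i]) (F g : C -> C).

Lemma cdiff_derivable F (z : C) : cdiff F z -> derivable F z 1.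
Proof.
move=> [L HL]; apply/cvg_ex; exists L => /=; apply/cvgc_normP => e e0.
have [|d d0 H] := HL (e / 2); first by rewrite divr_gt0.
rewrite /dnbhs /=; apply/near0_normcP; exists d => // h hd h0.
have := H (h + z); rewrite addrK => /(_ hd) {}H.
have nh : 0 < normc h by rewrite normc_gt0.
rewrite scaler1 -(ltr_pM2r nh) -normcM mulrBl -[_ *: _]/(_ * _) mulrAC mulVf // mul1r.
by rewrite (le_lt_trans H) // ltr_pM2r //; lra.
Qed.

Lemma cdiff_difference_quotient F (z0 z : C) : (forall z : C, derivable F z 1) -> z != z0 ->
  cdiff (fun z => F z * (z - z0)^-1 + (- F z0) * (z - z0)^-1) z.
Proof.
by move=> Fd zz0; apply: derivable_cdiff; exact: (derivable_difference_quotient Fd zz0).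
Qed.

Lemma difference_quotient_bounded F (z0 p u : C) : (forall z : C, derivable F z 1) ->
  exists B, forall z, in_square p u z ->
    normc (F z * (z - z0)^-1 + (- F z0) * (z - z0)^-1) <= B.
Proof.
move=> Fd; apply: bounded_on_square => z _.
have [->|zz0] := eqVneq z z0.
  have [d d0 [B HB]] := cdiff_bounded (derivable_cdiff (Fd z0)).
  (* The maximum with 0 covers [w = z0], where the inverse of 0 is 0 and the expression vanishes. *)
  exists d => //; exists (Num.max B 0) => w /HB; rewrite -mulrDl.
  have [->|wz0] := eqVneq w z0; first by rewrite subrr mul0r normc0 le_max lexx orbT.
  rewrite normcM normcV -ler_pdivrMr ?normc_gt0 ?subr_eq0 // => h.
  by rewrite le_max h.
pose G w := F w * (w - z0)^-1 + (- F z0) * (w - z0)^-1.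
have [d d0 [B HB]] := cdiff_bounded (cdiff_difference_quotient Fd zz0 : cdiff G z).
exists d => //; exists (`|B| * d + normc (G z)) => w wd.
rewrite -[X in normc X]/(G w) -[G w](subrK (G z)) (le_trans (le_normcD _ _)) // lerD2r.
rewrite (le_trans (HB w wd)) // (le_trans (ler_wpM2r (normc_ge0 _) (ler_norm B))) //.
by rewrite ler_wpM2l // ltW.
Qed.

(* The two sides not through [z0] of the square with corner [z0] and sides [v], ['i * v]. *)
Definition outer_sum F n (z0 v : R[i]) : R[i] :=
  edge_sum F n (z0 + v) (z0 + v + 'i * v) + edge_sum F n (z0 + v + 'i * v) (z0 + 'i * v).

Lemma complexDi (a b : R) : a +i* b = a%:C + 'i * b%:C.
Proof. exact: (complexE (a +i* b)). Qed.

Lemma outer_segment1 z0 v (t : R) :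
  z0 + v + t%:C * (z0 + v + 'i * v - (z0 + v)) - z0 = v * (1 +i* t).
Proof. by rewrite complexDi rmorph1; ring. Qed.

Lemma outer_segment2 z0 v (t : R) :
  z0 + v + 'i * v + t%:C * (z0 + 'i * v - (z0 + v + 'i * v)) - z0 = v * ((1 - t) +i* 1).
Proof. by rewrite complexDi rmorphB rmorph1; ring. Qed.

(** On the two sides the integrand is i / (1 + i t) and -1 / (1 - t + i), with imaginary parts 1 /
    (1 + t^2) and 1 / (1 + (1 - t)^2), each at least 1/2. The exact integral would give pi / 2. *)
Lemma outer_sum_inv_Im n z0 v : v != 0 ->
  1 <= complex.Im (outer_sum (fun z => (z - z0)^-1) n z0 v).
Proof.
move=> v0; have ImD z w : complex.Im (z + w) = complex.Im z + complex.Im w by case: z w => ? ? [].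
have half (t : R) : 0 <= t <= 1 -> 2^-1 <= (1 + t ^+ 2)^-1.
  move=> ht; have := sqr_ge0 t; rewrite lef_pV2 ?posrE; nra.
rewrite /outer_sum ImD; have -> : (1 : R) = 2^-1 + 2^-1 by field.
rewrite lerD //; apply: edge_sum_Im => t ht.
  rewrite outer_segment1 invfM mulrAC.
  have -> : v^-1 * (z0 + v + 'i * v - (z0 + v)) = 'i by rewrite (addrC (z0 + v)) addrK mulrC mulfK.
  rewrite /= (le_trans (half t ht)) // expr1n; nra.
rewrite outer_segment2 invfM mulrAC.
have -> : v^-1 * (z0 + 'i * v - (z0 + v + 'i * v)) = -1.
  have -> : z0 + 'i * v - (z0 + v + 'i * v) = - v by ring.
  by rewrite mulrN mulVf.
have h1 : 0 <= 1 - t <= 1 by lra.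
rewrite mulN1r /= (le_trans (half _ h1)) // expr1n addrC; nra.
Qed.

(** On these sides |z - z0| lies between |v| and 2 |v|, so the integrand is at most B / |v| over a
    total length 2 |v|. *)
Lemma outer_sum_le F n z0 v B : v != 0 ->
  (forall w, normc v <= normc (w - z0) <= 2 * normc v -> normc (F w) <= B) ->
  normc (outer_sum (fun z => F z * (z - z0)^-1) n z0 v) <= 2 * B.
Proof.
move=> v0 HF.
have nv : 0 < normc v by rewrite normc_gt0.
have bnd w c : w - z0 = v * c -> 1 <= normc c <= 2 -> normc (F w * (w - z0)^-1) <= B / normc v.
  move=> E hc.
  have wv : normc v <= normc (w - z0) <= 2 * normc v.
    by rewrite E normcM; apply/andP; split; nra.
  have Fw := HF w wv; have F0 := normc_ge0 (F w).
  rewrite normcM normcV ler_pM ?invr_ge0 ?normc_ge0 // lef_pV2 ?posrE //; lra.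
rewrite /outer_sum (le_trans (le_normcD _ _)) //.
have -> : 2 * B = B / normc v * normc v + B / normc v * normc v.
  by field; apply: lt0r_neq0.
rewrite lerD //.
  have {2}-> : normc v = normc (z0 + v + 'i * v - (z0 + v)).
    by rewrite addrC addKr normcM normc_i mul1r.
  apply: edge_sum_le => t ht; apply: bnd (outer_segment1 _ _ _) _.
  apply/andP; split; first by apply: le_trans (ler_Re _); rewrite /= normr1.
  by apply: le_trans (normc_ReIm _) _; rewrite /= normr1 ger0_norm; lra.
have {2}-> : normc v = normc (z0 + 'i * v - (z0 + v + 'i * v)).
  by rewrite normcB; congr normc; ring.
apply: edge_sum_le => t ht; apply: bnd (outer_segment2 _ _ _) _.
apply/andP; split; first by apply: le_trans (ler_Im _); rewrite /= normr1.
by apply: le_trans (normc_ReIm _) _; rewrite /= normr1 ger0_norm; lra.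
Qed.

(* A weak maximum principle: Cauchy's formula on the boundary of the square of centre
   [z0] and half side [rho], whose points are at distance between [rho] and [2 * rho]. *)
Lemma annulus_bound F (z0 : C) (rho B : R) : 0 < rho -> (forall z : C, derivable F z 1) ->
  (forall w, rho <= normc (w - z0) <= 2 * rho -> normc (F w) <= B) ->
  normc (F z0) <= 2 * B.
Proof.
move=> rho0 Fd FB; pose q z := (z - z0)^-1.
pose G z := F z * q z + (- F z0) * q z.
(* Each square is the previous one after a quarter turn about [z0]; since ['i * v3 = v0], the sides
   through [z0] cancel in pairs and only the outer sides remain. *)
pose v0 := rho%:C; pose v1 := 'i * v0; pose v2 := 'i * v1; pose v3 := 'i * v2.
have v0n : v0 != 0 by rewrite fmorph_eq0 lt0r_neq0.
have i0 : ('i : R[i]) != 0 by rewrite -normc_gt0 normc_i.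
have v1n : v1 != 0 by rewrite mulf_neq0.
have v2n : v2 != 0 by rewrite mulf_neq0.
have v3n : v3 != 0 by rewrite mulf_neq0.
have nv0 : normc v0 = rho by rewrite normc_real gtr0_norm.
have nv1 : normc v1 = rho by rewrite normcM normc_i mul1r.
have nv2 : normc v2 = rho by rewrite normcM normc_i mul1r.
have nv3 : normc v3 = rho by rewrite normcM normc_i mul1r.
have small e v : 0 < e -> v != 0 -> small_sums G z0 v e.
  move=> e0 vn; have [B' HB'] := difference_quotient_bounded z0 z0 v Fd.
  by apply: (goursat_corner e0 vn _ HB') => z _; apply: cdiff_difference_quotient.
apply/ler_addgt0Pr => e e0.
suff [n [H0 H1 H2 H3]] : exists n, [/\ normc (square_sum G n z0 v0) <= e,
    normc (square_sum G n z0 v1) <= e, normc (square_sum G n z0 v2) <= e &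
    normc (square_sum G n z0 v3) <= e].
  have sumE v : square_sum G n z0 v = edge_sum G n z0 (z0 + v) + outer_sum G n z0 v
      + edge_sum G n (z0 + 'i * v) z0.
    by rewrite /square_sum /outer_sum !addrA.
  have iv3 : 'i * v3 = v0.
    have ii : 'i * 'i = -1 :> R[i] by rewrite -expr2 sqr_i.
    by rewrite /v3 /v2 /v1 !mulrA ii mulN1r mulNr ii opprK mul1r.
  have E : square_sum G n z0 v0 + square_sum G n z0 v1 + square_sum G n z0 v2
      + square_sum G n z0 v3 =
      (outer_sum (fun z => F z * q z) n z0 v0 + outer_sum (fun z => F z * q z) n z0 v1
      + outer_sum (fun z => F z * q z) n z0 v2 + outer_sum (fun z => F z * q z) n z0 v3)
      + (- F z0) * (outer_sum q n z0 v0 + outer_sum q n z0 v1 + outer_sum q n z0 v2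
      + outer_sum q n z0 v3).
    rewrite !sumE iv3 -/v1 -/v2 -/v3.
    rewrite !(edge_sum_rev G n z0 (_ + _)) /outer_sum /G !edge_sum_linear; ring.
  have := normcD4_le H0 H1 H2 H3; rewrite E addrC => /(le_trans (normcDr_le _ _)).
  set X := outer_sum q _ _ _ + _ + _ + _; set Y := outer_sum _ _ _ v0 + _ + _ + _.
  have hY : normc Y <= 2 * B + 2 * B + 2 * B + 2 * B.
    by apply: normcD4_le; apply: outer_sum_le => // w; rewrite ?nv0 ?nv1 ?nv2 ?nv3; apply: FB.
  have hX : 4 <= normc X.
    apply: le_trans (ler_Im X); apply: le_trans (ler_norm _).
    have ImD z w : complex.Im (z + w) = complex.Im z + complex.Im w.
      by case: z w => ? ? [].
    rewrite /X 3!(ImD _ (outer_sum _ _ _ _)).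
    have H v : v != 0 -> 1 <= complex.Im (outer_sum q n z0 v) := @outer_sum_inv_Im n z0 v.
    by have := H _ v0n; have := H _ v1n; have := H _ v2n; have := H _ v3n; lra.
  (* The two bounds combine to 4 |F z0| <= 8 B + 4 e. *)
  rewrite normcM normcN; have := normc_ge0 (F z0).
  by nra.
near \oo => n; exists n; split; near: n; exact: small.
Unshelve. all: by end_near. Qed.

(** The subtracted geometric tail is what makes the induction close. *)
Lemma sum_geometric_le (u : nat -> R) (M : R) n :
  (forall k, u k * 2 ^+ k <= M) -> \sum_(k < n) u k <= 2 * M - 2 * M / 2 ^+ n.
Proof.
move=> H; elim: n => [|n IH]; first by rewrite big_ord0 expr0 divr1 subrr.
rewrite big_ord_recr /=; have : u n <= M / 2 ^+ n by rewrite ler_pdivlMr ?exprn_gt0.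
have -> : 2 * M / 2 ^+ n.+1 = M / 2 ^+ n.
  by rewrite exprS; field; apply: lt0r_neq0; rewrite exprn_gt0.
move: IH; rewrite -[2 * M / _]mulrA; lra.
Qed.

Lemma series_bounded (c : nat -> R[i]) (r M : R) n z :
  0 <= r -> (forall k, normc (c k) * (2 * r) ^+ k <= M) -> normc z <= r ->
  normc (series (fun k => c k * z ^+ k) n) <= 2 * M.
Proof.
move=> r0 H zr; rewrite /series /= big_mkord (le_trans (normc_sum _ _ _)) //.
have M0 : 0 <= M.
  by apply: le_trans (H 0%N); rewrite expr0 mulr1 normc_ge0.
have : \sum_(k < n) normc (c k * z ^+ k) <= 2 * M - 2 * M / 2 ^+ n.
  apply: (@sum_geometric_le (fun k => normc (c k * z ^+ k))) => k.
  apply: le_trans (H k); rewrite exprMn mulrA (mulrAC _ _ (r ^+ k)) ler_pM2r ?exprn_gt0 //.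
  by rewrite normcM normcX ler_wpM2l ?normc_ge0 // lerXn2r ?nnegrE ?normc_ge0.
have : 0 <= 2 * M / 2 ^+ n by rewrite divr_ge0 ?mulr_ge0 ?exprn_ge0.
lra.
Qed.

Lemma entire_taylor (f : C -> C) (c : nat -> C) :
  entire f -> taylor_at0 f c ->
  (forall r : R, 0 < r -> exists M, forall k, normc (c k) * r ^+ k <= M) ->
  forall z : C, series (fun k => c k * z ^+ k) @ \oo --> f z.
Proof.
move=> fd ft cb z0; have [->|z0n] := eqVneq z0 0.
  exact: (nbhs_singleton ft).
pose S n (z : C) := series (fun k => c k * z ^+ k) n : C.
have SE n z : S n z = \sum_(k < n) c k * z ^+ k by rewrite /S /series /= big_mkord.
have [M2 HM2] := cb 2 (ltr0n _ 2).
have M20 : 0 <= M2 by apply: le_trans (HM2 0%N); rewrite expr0 mulr1 normc_ge0.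
have [d0 d00 /= ft'] := (near0_normcP _).1 ft.
(* The remainder of order [n] is O(z^n) near 0; this is needed for the derivability of the Taylor
   quotients at 0. *)
have tail n z : normc z < d0 -> normc z <= 1 ->
    normc (f z - S n z) <= 2 * M2 * normc z ^+ n.
  move=> zd z1; have /cvgc_normP Hz := ft' z zd.
  apply/ler_addgt0Pr => e /Hz [N _ /(_ (n + N)%N)]; rewrite /= leq_addl => /(_ isT).
  rewrite -/(S (n + N)%N z) normcB => hN.
  rewrite -(subrK (S (n + N)%N z) (f z)) -addrA addrC.
  rewrite (le_trans (le_normcD _ _)) // lerD //; last exact: ltW.
  rewrite !SE big_split_ord /= addrC addKr.
  have -> : \sum_(i < N) c (n + i)%N * z ^+ (n + i) =
      z ^+ n * series (fun k => c (n + k)%N * z ^+ k) N.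
    rewrite /series /= big_mkord mulr_sumr; apply: eq_bigr => i _.
    by rewrite exprD; ring.
  rewrite normcM normcX mulrC ler_wpM2r ?exprn_ge0 ?normc_ge0 //.
  apply: (@series_bounded _ 1) => // k; rewrite mulr1 (le_trans _ (HM2 (n + k)%N)) //.
  by rewrite ler_wpM2l ?normc_ge0 // ler_weXn2l ?leq_addl // ler1n.
(* The value [c n] removes the singularity at 0. *)
pose fn n (z : C) : C := if z == 0 then c n else (f z - S n z) / z ^+ n.
have fnd n (z : C) : derivable (fn n) z 1.
  have [->|zn] := eqVneq z 0; last first.
    exact: (@derivable_taylor_quotient C f c n (c n) z fd zn).
  (* What remains after the terms of index [n] and [n.+1] is the remainder of order [n.+2] over w^n,
     hence O(w^2). *)
  apply: cdiff_derivable; exists (c n.+1) => e e0.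
  exists (Num.min (Num.min d0 1) (e / (2 * M2 + 1))).
    by rewrite !lt_min d00 ltr01 divr_gt0 //; lra.
  move=> w; rewrite subr0 /fn eqxx !lt_min => /andP[/andP[wd w1] we].
  have [->|wn] := eqVneq w 0; first by rewrite subrr mulr0 subrr normc0 mulr0.
  have wg : 0 < normc w by rewrite normc_gt0.
  have -> : (f w - S n w) / w ^+ n - c n - c n.+1 * w = (f w - S n.+2 w) / w ^+ n.
    rewrite !SE !big_ord_recr /= exprS.
    by field; rewrite expf_neq0.
  rewrite normcM normcV normcX ler_pdivrMr ?exprn_gt0 //.
  apply: le_trans (tail _ _ wd (ltW w1)) _.
  rewrite -(add2n n) exprD mulrA ler_wpM2r ?exprn_ge0 ?normc_ge0 //.
  rewrite expr2 mulrA ler_pM2r //.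
  by move: we; rewrite ltr_pdivlMr; nra.
have nz : 0 < normc z0 by rewrite normc_gt0.
pose r := normc z0.
(* The disc of radius 7 r lies in the square with corner -(7 r + 7 r i) and side 14 r. *)
have [Bf HBf] : exists B, forall w, normc w <= 7 * r -> normc (f w) <= B.
  have [B HB] : exists B, forall z, in_square (- ((7 * r) +i* (7 * r))) (14 * r)%:C z ->
      normc (f z) <= B.
    apply: bounded_on_square => z _.
    have [d d1 [B HB]] := cdiff_bounded (derivable_cdiff (fd z)).
    exists d => //; exists (`|B| * d + normc (f z)) => w wd.
    rewrite -[X in normc X](subrK (f z)) (le_trans (le_normcD _ _)) // lerD2r.
    rewrite (le_trans (HB w wd)) // (le_trans (ler_wpM2r (normc_ge0 _) (ler_norm B))) //.
    by rewrite ler_wpM2l // ltW.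
  exists B => w wr; apply: HB.
  have r14 : 0 < 14 * r by rewrite mulr_gt0.
  have := le_trans (ler_Re w) wr; have := le_trans (ler_Im w) wr.
  rewrite !ler_norml => hi hr.
  exists ((complex.Re w + 7 * r) / (14 * r)), ((complex.Im w + 7 * r) / (14 * r)); split.
  - by rewrite ler_pdivlMr // ler_pdivrMr //; lra.
  - by rewrite ler_pdivlMr // ler_pdivrMr //; lra.
  apply/eqP; rewrite eq_complex /=; apply/andP; split; apply/eqP; field; exact: lt0r_neq0.
have [M HM] : exists M, forall k, normc (c k) * (2 * (7 * r)) ^+ k <= M.
  by apply: cb; rewrite !mulr_gt0.
have main n : normc (f z0 - S n z0) <= 2 * (Bf + 2 * M) * 2^-1 ^+ n.
  have fnE (w : C) : w != 0 -> fn n w = (f w - S n w) / w ^+ n by move=> wn; rewrite /fn ifN.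
  have -> : f z0 - S n z0 = fn n z0 * z0 ^+ n by rewrite fnE // mulfVK // expf_neq0.
  have -> : 2 * (Bf + 2 * M) * 2^-1 ^+ n = 2 * ((Bf + 2 * M) / (2 * r) ^+ n) * r ^+ n.
    by rewrite exprMn exprVn; field; rewrite !expf_neq0 //; exact: lt0r_neq0.
  rewrite normcM normcX ler_pM2r ?exprn_gt0 //.
  have r3 : 0 < 3 * r by rewrite mulr_gt0.
  (* With |z0| = r and 3 r <= |w - z0| <= 6 r, one has 2 r <= |w| <= 7 r. Dividing by w^n gains (2
     r)^-n and multiplying back by z0^n costs only r^n, which leaves the factor 2^-n. *)
  apply: (@annulus_bound (fn n) z0 (3 * r) _ r3 (fnd n)).
  move=> w /andP[w1 w2].
  have wr1 : 2 * r <= normc w.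
    by have := le_trans w1 (le_normcD w (- z0)); rewrite normcN -/r; lra.
  have wr2 : normc w <= 7 * r.
    by have := le_normcD (w - z0) z0; rewrite subrK -/r; lra.
  have wn : w != 0 by rewrite -normc_gt0 (lt_le_trans _ wr1) // mulr_gt0.
  rewrite fnE // normcM normcV normcX.
  have h0 := normc_ge0 (f w - S n w).
  apply: ler_pM => //; first by rewrite invr_ge0 exprn_ge0 ?normc_ge0.
    rewrite (le_trans (le_normcD _ _)) // normcN lerD ?HBf //.
    by apply: series_bounded HM wr2; rewrite mulr_ge0 // ltW.
  have r20 : 0 < 2 * r by rewrite mulr_gt0.
  have w0 : 0 < normc w by apply: lt_le_trans wr1.
  by rewrite lef_pV2 ?posrE ?exprn_gt0 // lerXn2r ?nnegrE // ltW.
apply/cvgc_normP => e e0.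
have : 2 * (Bf + 2 * M) * 2^-1 ^+ n @[n --> \oo] --> 2 * (Bf + 2 * M) * 0.
  by apply: cvgMr; apply: cvg_expr; rewrite ger0_norm; lra.
rewrite mulr0 => /cvgrPdist_lt/(_ e e0); apply: filterS => n.
rewrite sub0r normrN => hn; rewrite normcB.
by apply: le_lt_trans (main n) (le_lt_trans (ler_norm _) hn).
Unshelve. all: by end_near. Qed.

End EntireTaylor.

(** * Pochhammer symbols and factorials *)

Section Pochhammer.
Context {K : numFieldType}.

Lemma fact_prod_succ m N :
  (m`!%:R * \prod_(j < N) (m.+1 + j)%:R = (m + N)`!%:R :> K)%R.
Proof.
elim: N => [|N IH]; first by rewrite big_ord0 mulr1 addn0.
by rewrite big_ord_recr /= mulrA IH addnS factS natrM mulrC addSn.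
Qed.

(* The [N] lower parameters fill the residues modulo [N], so that the product of their
   Pochhammer symbols telescopes into a single factorial. *)
Lemma prod_pochhammer N r l : (0 < N)%N ->
  \prod_(c <- [seq (N.+1 + r + j)%:R / N%:R | j <- iota 0 N]) pochhammer c l *
    (N + r)`!%:R * N%:R ^+ (N * l) = (N + r + l * N)`!%:R :> K.
Proof.
move=> N0; have Nn : N%:R != 0 :> K by rewrite pnatr_eq0 -lt0n.
rewrite big_map (_ : iota 0 N = index_iota 0 N) ?big_mkord; last by rewrite /index_iota subn0.
elim: l => [|l IH].
  by rewrite muln0 expr0 mul0n addn0 mulr1 big1 ?mul1r // => j _; rewrite /pochhammer big_ord0.
rewrite mulSn (addnC N (l * N)) addnA -(fact_prod_succ (N + r + l * N)) -IH mulnS exprD.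
have -> : \prod_(j < N) pochhammer ((N.+1 + r + j)%:R / N%:R : K) l.+1 =
    (\prod_(j < N) pochhammer ((N.+1 + r + j)%:R / N%:R : K) l) *
    ((\prod_(j < N) ((N + r + l * N).+1 + j)%:R) / N%:R ^+ N).
  have -> : N%:R ^+ N = \prod_(j < N) N%:R :> K by rewrite prodr_const card_ord.
  rewrite -prodf_div -big_split /=.
  apply: eq_bigr => j _; rewrite /pochhammer big_ord_recr /=; congr (_ * _).
  by rewrite -[N.+1]addn1 -[(N + r + l * N).+1]addn1 !(natrD, natrM); field.
by field; rewrite expf_neq0.
Qed.

(** The upper parameter 1 cancels the [l!] of the general term, and the powers of [N] cancel those
    of the argument; only a quotient of factorials is left. *)
Lemma hypergeometric_fact N r (g z : K) : (0 < N)%N ->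
  hypergeometric [:: 1] [seq (N.+1 + r + j)%:R / N%:R | j <- iota 0 N]
    (g * z ^+ N / N%:R ^+ N) =
  limn (series (fun l => (N + r)`!%:R / (N + r + l * N)`!%:R * (g * z ^+ N) ^+ l)).
Proof.
move=> N0; have Nn : N%:R != 0 :> K by rewrite pnatr_eq0 -lt0n.
rewrite /hypergeometric; congr (limn (series _)); apply/funext => l.
have fn0 k : k`!%:R != 0 :> K by rewrite pnatr_eq0 -lt0n fact_gt0.
rewrite -(prod_pochhammer r l N0) big_seq1.
have -> : pochhammer (1 : K) l = l`!%:R.
  have := fact_prod_succ 0 l; rewrite fact0 mul1r add0n => <-.
  by apply: eq_bigr => j _; rewrite natrD.
have P0 : \prod_(c <- [seq (N.+1 + r + j)%:R / N%:R | j <- iota 0 N]) pochhammer (c : K) l != 0.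
  apply/eqP => P0; have /eqP := prod_pochhammer r l N0.
  by rewrite P0 !mul0r eq_sym (negbTE (fn0 _)).
rewrite expr_div_n -exprM mulnC; field.
by rewrite P0 !fn0 expf_neq0.
Qed.

End Pochhammer.

(** * Convergence of real and complex series *)

Section ComplexSeries.
Context {R : realType}.
Let C : numFieldType := R[i].

Lemma exp_coeff_bounded (x : R) : exists M, forall k, `|x| ^+ k / k`!%:R <= M.
Proof.
have /cvgP/cvg_seq_bounded[M [_ HM]] := cvg_exp_coeff `|x|.
exists (M + 1) => k; have := HM (M + 1); rewrite ltrDl ltr01 => /(_ isT k I).
by apply: le_trans; exact: ler_norm.
Qed.

Lemma ReB (z w : R[i]) : complex.Re (z - w) = complex.Re z - complex.Re w.
Proof. by case: z w => ? ? []. Qed.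

Lemma ImB (z w : R[i]) : complex.Im (z - w) = complex.Im z - complex.Im w.
Proof. by case: z w => ? ? []. Qed.

Lemma cvg_ReIm (u : nat -> C) (x y : R) :
  (fun n => complex.Re (u n)) @ \oo --> x -> (fun n => complex.Im (u n)) @ \oo --> y ->
  u @ \oo --> (x +i* y : C).
Proof.
move=> /cvgrPdist_lt hx /cvgrPdist_lt hy; apply/cvgc_normP => e e0.
have e2 : 0 < e / 2 by rewrite divr_gt0.
near=> n; rewrite normcB (le_lt_trans (normc_ReIm _)) //.
rewrite ReB ImB /= [e]splitr ltrD //; near: n; [exact: hx|exact: hy].
Unshelve. all: by end_near. Qed.

Lemma cvg_Re (u : nat -> C) (z : C) : u @ \oo --> z ->
  (fun n => complex.Re (u n)) @ \oo --> complex.Re z.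
Proof.
move=> /cvgc_normP H; apply/cvgrPdist_lt => e /H; apply: filterS => n.
by apply: le_lt_trans; rewrite normcB -ReB; exact: ler_Re.
Qed.

Lemma cvg_Im (u : nat -> C) (z : C) : u @ \oo --> z ->
  (fun n => complex.Im (u n)) @ \oo --> complex.Im z.
Proof.
move=> /cvgc_normP H; apply/cvgrPdist_lt => e /H; apply: filterS => n.
by apply: le_lt_trans; rewrite normcB -ImB; exact: ler_Im.
Qed.

Lemma Re_sum I (r : seq I) (P : pred I) (F : I -> R[i]) :
  complex.Re (\sum_(i <- r | P i) F i) = \sum_(i <- r | P i) complex.Re (F i).
Proof. by apply: (big_morph _ _ (erefl _)) => -[? ?] [? ?]. Qed.

Lemma Im_sum I (r : seq I) (P : pred I) (F : I -> R[i]) :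
  complex.Im (\sum_(i <- r | P i) F i) = \sum_(i <- r | P i) complex.Im (F i).
Proof. by apply: (big_morph _ _ (erefl _)) => -[? ?] [? ?]. Qed.

Lemma is_cvg_series_dominated (u : nat -> R) (M : R) :
  (forall k, `|u k| * 2 ^+ k <= M) -> cvgn (series u).
Proof.
move=> H; apply: normed_cvg.
have le k : `|u k| <= geometric M 2^-1 k.
  by rewrite /geometric /= exprVn ler_pdivlMr ?exprn_gt0.
have v0 k : 0 <= geometric M 2^-1 k := le_trans (normr_ge0 _) (le k).
apply: (series_le_cvg _ v0 le) => [k|]; first exact: normr_ge0.
by apply: is_cvg_geometric_series; rewrite ger0_norm; lra.
Qed.

Lemma is_cvg_complex_series_dominated (u : nat -> C) (M : R) :
  (forall k, normc (u k) * 2 ^+ k <= M) -> cvgn (series u).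
Proof.
move=> H.
have cRe : cvgn (series (fun k => complex.Re (u k))).
  apply: (@is_cvg_series_dominated _ M) => k.
  by rewrite (le_trans _ (H k)) // ler_wpM2r ?exprn_ge0 ?ler_Re.
have cIm : cvgn (series (fun k => complex.Im (u k))).
  apply: (@is_cvg_series_dominated _ M) => k.
  by rewrite (le_trans _ (H k)) // ler_wpM2r ?exprn_ge0 ?ler_Im.
apply: (cvgP (limn (series (fun k => complex.Re (u k))) +i*
   limn (series (fun k => complex.Im (u k))) : C)).
apply: cvg_ReIm.
  by rewrite (_ : (fun n => _) = series (fun k => complex.Re (u k)) :> (nat -> R)) //;
    apply/funext => n; rewrite /series /= Re_sum.
by rewrite (_ : (fun n => _) = series (fun k => complex.Im (u k)) :> (nat -> R)) //;
  apply/funext => n; rewrite /series /= Im_sum.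
Qed.

End ComplexSeries.

(** * The power series of the recurrence and its hypergeometric sum *)

Lemma cvg_linear_combination (K : numFieldType) N (c : nat -> K) (u : nat -> nat -> K)
    (l : nat -> K) : (forall r, u r @ \oo --> l r) ->
  (fun n => \sum_(r < N) c r * u r n) @ \oo --> \sum_(r < N) c r * l r.
Proof.
move=> ul; elim: N => [|N IH].
  rewrite big_ord0 (_ : (fun n => _) = cst 0); first exact: cvg_cst.
  by apply/funext => n; rewrite big_ord0.
rewrite big_ord_recr /= (_ : (fun n => _) =
    (fun n => \sum_(r < N) c r * u r n) + (fun n => c N * u N n)).
  by apply: (cvgD IH); apply: cvgMr; apply: ul.
by apply/funext => n; rewrite big_ord_recr.
Qed.

Lemma cvg_affine_combination (K : numFieldType) N (c0 : K) (c : nat -> K)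
    (u : nat -> nat -> K) (l : nat -> K) : (forall r, u r @ \oo --> l r) ->
  (fun n => c0 + \sum_(r < N) c r * u r n) @ \oo --> c0 + \sum_(r < N) c r * l r.
Proof.
move=> ul; rewrite (_ : (fun n => _) = cst c0 + (fun n => \sum_(r < N) c r * u r n)) //.
by apply: cvgD; [exact: cvg_cst|exact: cvg_linear_combination].
Qed.

Section HypergeometricSeries.
Context {R : realType}.
Let C : numFieldType := R[i].
Variables (a : nat -> R) (g : R) (N : nat).
Hypothesis N0 : (0 < N)%N.

(* The solution of [(k + N)`! * b (k + N) = g * k`! * b k] with [b r = a r] for [r < N]. *)
Definition recurrent_coef k : R :=
  g ^+ (k %/ N) * (k %% N)`!%:R * a (k %% N)%N / k`!%:R.

Lemma recurrent_coef_lt r : (r < N)%N -> recurrent_coef r = a r.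
Proof.
move=> rN; rewrite /recurrent_coef divn_small // modn_small // expr0 mul1r.
by rewrite mulrC mulKf // pnatr_eq0 -lt0n fact_gt0.
Qed.

Lemma recurrent_coefS k :
  (k + N)`!%:R * recurrent_coef (k + N)%N = g * k`!%:R * recurrent_coef k.
Proof.
have fn0 m : m`!%:R != 0 :> R by rewrite pnatr_eq0 -lt0n fact_gt0.
rewrite /recurrent_coef modnDr divnDr ?dvdnn // divnn N0 addn1 exprS.
by field; rewrite !fn0.
Qed.

(** A factor [g] enters only once every [N] indices, so the coefficients are at most A G^k / k! and
    the factorial beats every r^k. *)
Lemma recurrent_coef_bounded r : 0 < r ->
  exists M, forall k, normc (recurrent_coef k)%:C * r ^+ k <= M.
Proof.
(* [G] is at least 1, so that [G ^+ (k %/ N) <= G ^+ k]. *)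
move=> r0; pose G := 1 + `|g|; pose A := \sum_(i < N) i`!%:R * `|a i|.
have G1 : 1 <= G by rewrite lerDl.
have [M HM] := exp_coeff_bounded (G * r); exists (A * M) => k.
have A0 : 0 <= A by apply: sumr_ge0 => i _; rewrite mulr_ge0.
rewrite normc_real /recurrent_coef !normrM normrX normfV !normr_nat.
have h1 : `|g| ^+ (k %/ N) <= G ^+ k.
  apply: (@le_trans _ _ (G ^+ (k %/ N))); first by rewrite lerXn2r ?nnegrE ?lerDr //; lra.
  by rewrite ler_weXn2l // leq_div.
have h2 : (k %% N)`!%:R * `|a (k %% N)%N| <= A.
  rewrite /A (bigD1 (Ordinal (ltn_pmod k N0))) //= lerDl.
  by apply: sumr_ge0 => i _; rewrite mulr_ge0.
have Gr0 : 0 <= G * r by apply: mulr_ge0; lra.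
have := HM k; rewrite (ger0_norm Gr0) exprMn.
move=> hM; apply: le_trans (ler_wpM2l A0 hM).
have -> : A * (G ^+ k * r ^+ k / k`!%:R) = G ^+ k * A / k`!%:R * r ^+ k by ring.
rewrite ler_wpM2r ?exprn_ge0 //; first lra.
rewrite ler_wpM2r ?invr_ge0 // -[leLHS]mulrA ler_pM ?exprn_ge0 // mulr_ge0 //.
Qed.

(** In each residue class r modulo [N] the term of index r stands apart; the terms of index N + r +
    i N form the hypergeometric series, with common factor g r! a_r z^(N+r) / (N + r)!. *)
Definition hypergeometric_form (z : C) : C :=
  \sum_(r < N) (a r)%:C * z ^+ r +
  g%:C * z ^+ N *
  \sum_(r < N) (r`!%:R * a r / (N + r)`!%:R)%:C * z ^+ r *
    hypergeometric [:: 1] [seq (N.+1 + r + j)%:R / N%:R | j <- iota 0 N]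
      (g%:C * z ^+ N / N%:R ^+ N).

Lemma series_recurrent_coef (z : C) :
  series (fun k => (recurrent_coef k)%:C * z ^+ k) @ \oo --> hypergeometric_form z.
Proof.
have : cvgn (series (fun k => (recurrent_coef k)%:C * z ^+ k : C)).
  have r0 : 0 < 2 * (normc z + 1) by have := normc_ge0 z; lra.
  have [M HM] := recurrent_coef_bounded r0.
  apply: (@is_cvg_complex_series_dominated _ _ M) => k; apply: le_trans (HM k).
  rewrite normcM normcX exprMn -mulrA ler_wpM2l ?normc_ge0 // mulrC.
  by rewrite ler_wpM2l ?exprn_ge0 // lerXn2r ?nnegrE ?normc_ge0 //; have := normc_ge0 z; lra.
(* Convergence being known, the limit may be computed along the partial sums of length [L.+1 * N],
   which consist of whole periods. *)
move=> /cvg_ex[/= l Hl]; suff <- : l = hypergeometric_form z by [].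
pose t r i : C := (N + r)`!%:R / (N + r + i * N)`!%:R * (g%:C * z ^+ N) ^+ i.
have ct r : series (t r) @ \oo --> limn (series (t r)).
  pose X := 2 * `|g| * normc z ^+ N.
  have X0 : 0 <= X by rewrite !mulr_ge0 ?exprn_ge0 ?normc_ge0.
  have [M HM] := exp_coeff_bounded X.
  apply: (@is_cvg_complex_series_dominated _ _ ((N + r)`!%:R * M)) => k.
  have nfact m : normc (m`!%:R : C) = m`!%:R.
    by rewrite -(rmorph_nat (real_complex R)) normc_real normr_nat.
  rewrite /t !(normcM, normcX, normcV, nfact, normc_real).
  apply: (@le_trans _ _ ((N + r)`!%:R * (X ^+ k / k`!%:R))); last first.
    by rewrite ler_wpM2l // -[X in X ^+ k](ger0_norm X0).
  rewrite -!mulrA ler_wpM2l // mulrC /X -!mulrA !exprMn -exprM.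
  rewrite [leLHS](_ : _ = (2 ^+ k * `|g| ^+ k * normc z ^+ (N * k)) * ((N + r + k * N)`!%:R)^-1);
    last by ring.
  rewrite !mulrA ler_wpM2l ?mulr_ge0 ?exprn_ge0 ?normc_ge0 //.
  rewrite lef_pV2 ?posrE ?ltr0n ?fact_gt0 // ler_nat leq_fact //.
  by rewrite (leq_trans (leq_pmulr k N0)) // leq_addl.
have E L : series (fun k => (recurrent_coef k)%:C * z ^+ k) (L.+1 * N)%N =
    \sum_(r < N) (a r)%:C * z ^+ r + \sum_(r < N)
      (g%:C * z ^+ N * ((r`!%:R * a r / (N + r)`!%:R)%:C * z ^+ r)) * series (t r) L.
  have fn0 m : m`!%:R != 0 :> R[i] by rewrite pnatr_eq0 -lt0n fact_gt0.
  elim: L => [|L IH].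
    rewrite mul1n {1}/series /= big_mkord [X in _ + X]big1 ?addr0 => [|r _].
      by apply: eq_bigr => r _; rewrite recurrent_coef_lt.
    by rewrite /series /= big_geq // mulr0.
  rewrite mulSn addnC {1}/series /= big_mkord big_split_ord /=.
  rewrite -(big_mkord xpredT (fun k => (recurrent_coef k)%:C * z ^+ k)).
  rewrite -[X in X + _ = _]/(series _ _) IH -addrA -big_split /=; congr (_ + _).
  apply: eq_bigr => r _; rewrite [series (t r) L.+1]/series /= big_nat_recr //= mulrDr.
  congr (_ + _).
  have -> : recurrent_coef (L.+1 * N + r)%N = g ^+ L.+1 * r`!%:R * a r / (L.+1 * N + r)`!%:R.
    by rewrite /recurrent_coef divnMDl // modnMDl modn_small // divn_small // addn0.
  have -> : (L.+1 * N + r = N + r + L * N)%N by rewrite mulSn; ring.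
  rewrite /t !exprD exprMn -exprM (mulnC N L).
  rewrite !fmorph_div !rmorphM rmorphXn /= !rmorph_nat exprS.
  by field; rewrite !fn0.
have H1 : series (fun k => (recurrent_coef k)%:C * z ^+ k) (L.+1 * N)%N @[L --> \oo] --> (l : C).
  move: Hl => /cvgc_normP Hl; apply/cvgc_normP => e /Hl[M _ HM]; exists M => // L ML.
  apply: HM => /=; rewrite (leq_trans ML) // (leq_trans (leqnSn L)) //.
  exact: leq_pmulr.
have H2 : series (fun k => (recurrent_coef k)%:C * z ^+ k) (L.+1 * N)%N @[L --> \oo] -->
    hypergeometric_form z.
  pose cc r : C := g%:C * z ^+ N * ((r`!%:R * a r / (N + r)`!%:R)%:C * z ^+ r).
  pose c0 : C := \sum_(r < N) (a r)%:C * z ^+ r.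
  have -> : hypergeometric_form z = c0 + \sum_(r < N) cc r * limn (series (t r)).
    rewrite /hypergeometric_form mulr_sumr; congr (_ + _).
    by apply: eq_bigr => i _; rewrite hypergeometric_fact // mulrA.
  have -> : (fun L => series (fun k => (recurrent_coef k)%:C * z ^+ k) (L.+1 * N)%N) =
      (fun L => c0 + \sum_(r < N) cc r * series (t r) L) by apply/funext => L; rewrite E.
  exact: (@cvg_affine_combination C N c0 cc _ _ ct).
by rewrite -(cvg_lim (@norm_hausdorff C C) H1) (cvg_lim (@norm_hausdorff C C) H2).
Qed.

End HypergeometricSeries.

(** * Termwise differentiation of series of real polynomials *)

Section PolynomialSeries.
Context {R : realType}.
Implicit Types (p : {poly R}) (P : nat -> {poly R}) (y h d b rho M : R).

(** A majorant of [p] on [-b, b] which also controls the derivative, at the price of a larger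
    radius. *)
Definition abs_horner p (b : R) : R := \sum_(i < size p) `|p`_i| * b ^+ i.

Lemma deriv_horner_coefs p y :
  p^`().[y] = \sum_(i < size p) p`_i * (y ^+ i.-1 *+ i).
Proof.
rewrite -{1}[p]coefK poly_def raddf_sum /= horner_sum; apply: eq_bigr => i _.
by rewrite derivZ derivXn hornerZ hornerMn hornerXn.
Qed.

Lemma abs_horner_ge0 p b : 0 <= b -> 0 <= abs_horner p b.
Proof. by move=> b0; apply: sumr_ge0 => i _; rewrite mulr_ge0 ?exprn_ge0. Qed.

Lemma abs_horner_wide p b n : (size p <= n)%N ->
  abs_horner p b = \sum_(i < n) `|p`_i| * b ^+ i.
Proof.
move=> pn; rewrite /abs_horner (big_ord_widen _ (fun i => `|p`_i| * b ^+ i) pn).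
rewrite [RHS](bigID (fun i : 'I_n => (i < size p)%N)) /= [X in _ + X]big1 ?addr0 // => i.
by rewrite -leqNgt => ?; rewrite nth_default // normr0 mul0r.
Qed.

Lemma ler_abs_horner p y b : `|y| <= b -> `|p.[y]| <= abs_horner p b.
Proof.
move=> yb; have b0 : 0 <= b := le_trans (normr_ge0 y) yb.
rewrite horner_coef (le_trans (ler_norm_sum _ _ _)) // ler_sum // => i _.
by rewrite normrM normrX ler_wpM2l // lerXn2r ?nnegrE.
Qed.

Lemma abs_horner_le p b c : 0 <= b -> b <= c -> abs_horner p b <= abs_horner p c.
Proof.
move=> b0 bc; apply: ler_sum => i _; rewrite ler_wpM2l // lerXn2r ?nnegrE //.
exact: le_trans bc.
Qed.

Lemma abs_hornerD p q b : 0 <= b -> abs_horner (p + q) b <= abs_horner p b + abs_horner q b.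
Proof.
move=> b0; rewrite !(@abs_horner_wide _ b (maxn (size p) (size q))) ?leq_maxl ?leq_maxr //.
  rewrite -big_split ler_sum //= => i _.
  by rewrite coefD -mulrDl ler_wpM2r ?exprn_ge0 // ler_normD.
exact: size_polyD.
Qed.

Lemma abs_hornerZ (c : R) p b : 0 <= b -> abs_horner (c *: p) b <= `|c| * abs_horner p b.
Proof.
move=> b0; rewrite (@abs_horner_wide _ b (size p)) ?size_scale_leq // mulr_sumr.
by apply: ler_sum => i _; rewrite coefZ normrM mulrA.
Qed.

Lemma abs_hornerMX p b : 0 <= b -> abs_horner (p * 'X) b <= b * abs_horner p b.
Proof.
move=> b0; rewrite (@abs_horner_wide _ b (size p).+1); last first.
  by have [->|p0] := eqVneq p 0; rewrite ?mul0r ?size_poly0 // size_mulX.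
rewrite big_ord_recl coefMX eqxx normr0 mul0r add0r mulr_sumr ler_sum // => i _.
by rewrite coefMX /= exprS mulrCA.
Qed.

(* The induction needs the sharper bound by the same remainder with [`|y|], [d]. *)
Lemma taylor2_monomial_le y h d i : 0 < d -> `|h| <= d ->
  `|(y + h) ^+ i - y ^+ i - h * (y ^+ i.-1 *+ i)| <=
    (h / d) ^+ 2 * ((`|y| + d) ^+ i - `|y| ^+ i - d * (`|y| ^+ i.-1 *+ i)).
Proof.
move=> d0 hd; elim: i => [|i IH].
  by rewrite !expr0 !mulr0n !mulr0 !subrr normr0 mulr0.
have step (u v : R) : (u + v) ^+ i.+1 - u ^+ i.+1 - v * (u ^+ i.+1.-1 *+ i.+1) =
    (u + v) * ((u + v) ^+ i - u ^+ i - v * (u ^+ i.-1 *+ i)) + v ^+ 2 * (u ^+ i.-1 *+ i).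
  case: i {IH} => [|i] /=; first by rewrite !expr0 !expr1 !mulr1n mulr0n; ring.
  by rewrite !exprS mulrSr -[u ^+ i *+ i.+1]mulr_natr; ring.
rewrite !step (le_trans (ler_normD _ _)) // [leRHS]mulrDr lerD //.
  rewrite normrM mulrCA ler_pM //.
  by rewrite (le_trans (ler_normD _ _)) // lerD2l.
by rewrite normrM (ger0_norm (sqr_ge0 h)) normrMn normrX mulrA -exprMn mulfVK ?lt0r_neq0.
Qed.

Lemma taylor2_le p y h d : 0 < d -> `|h| <= d ->
  `|p.[y + h] - p.[y] - h * p^`().[y]| <= (h / d) ^+ 2 * abs_horner p (`|y| + d).
Proof.
move=> d0 hd; rewrite deriv_horner_coefs !horner_coef !mulr_sumr -!sumrB.
rewrite (le_trans (ler_norm_sum _ _ _)) // ler_sum // => i _.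
have -> : p`_i * (y + h) ^+ i - p`_i * y ^+ i - h * (p`_i * (y ^+ i.-1 *+ i)) =
  p`_i * ((y + h) ^+ i - y ^+ i - h * (y ^+ i.-1 *+ i)) by ring.
rewrite normrM mulrCA ler_wpM2l // (le_trans (taylor2_monomial_le _ _ d0 hd)) //.
rewrite ler_wpM2l ?sqr_ge0 // -addrA gerDl -opprD oppr_le0 addr_ge0 ?exprn_ge0 //.
by rewrite mulr_ge0 ?mulrn_wge0 ?exprn_ge0 // ltW.
Qed.

(** A Cauchy estimate, term by term: d i b^(i-1) <= (b + d)^i, which follows from the nonnegativity
    of the second-order remainder in [taylor2_monomial_le]. *)
Lemma abs_horner_deriv p b d : 0 <= b -> 0 < d ->
  abs_horner p^`() b <= abs_horner p (b + d) / d.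
Proof.
move=> b0 d0; rewrite ler_pdivlMr //.
rewrite [leRHS](@abs_horner_wide _ _ (size p).-1.+1) ?leqSpred //.
have sz : (size p^`() <= (size p).-1)%N.
  by have [->|p0] := eqVneq p 0; rewrite ?deriv0 ?size_poly0 //
    -ltnS prednK ?lt_size_deriv ?size_poly_gt0.
rewrite (abs_horner_wide _ sz) mulr_suml.
rewrite big_ord_recl ler_wpDl //.
  by rewrite mulr_ge0 ?exprn_ge0 ?addr_ge0 // ltW.
apply: ler_sum => i _; rewrite coef_deriv normrMn lift0 -!mulrA mulrnAl -mulrnAr ler_wpM2l //.
have dd : `|d| <= d by rewrite gtr0_norm.
have := @taylor2_monomial_le b d d i.+1 d0 dd.
rewrite (ger0_norm b0) divff ?lt0r_neq0 // expr1n mul1r => /(le_trans (normr_ge0 _)) /=.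
rewrite -mulrnAl mulrC; have : 0 <= b ^+ i.+1 by rewrite exprn_ge0.
lra.
Qed.

Definition poly_series P y : R := limn (series (fun k => (P k).[y])).

(* The factor [2 ^+ k] makes every series dominated by [M / 2 ^+ k], and the condition is stable
   under differentiation since [b] ranges over an open interval. *)
Definition geometrically_bounded P rho := forall b, 0 <= b < rho ->
  exists M, forall k, abs_horner (P k) b * 2 ^+ k <= M.

Lemma geometrically_bounded_deriv P rho : geometrically_bounded P rho ->
  geometrically_bounded (fun k => (P k)^`()) rho.
Proof.
move=> HP b /andP[b0 br]; pose d := (rho - b) / 2.
have d0 : 0 < d by rewrite /d; lra.
have [|M HM] := HP (b + d); first by rewrite /d; lra.
exists (M / d) => k; apply: (@le_trans _ _ (abs_horner (P k) (b + d) / d * 2 ^+ k)).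
  by rewrite ler_wpM2r ?exprn_ge0 // abs_horner_deriv.
by rewrite mulrAC ler_wpM2r ?invr_ge0 ?HM // ltW.
Qed.

Lemma geometrically_bounded_derivn P rho j : geometrically_bounded P rho ->
  geometrically_bounded (fun k => (P k)^`(j)) rho.
Proof.
by elim: j => [//|j IH] HP; exact: (geometrically_bounded_deriv (IH HP)).
Qed.

Lemma is_cvg_poly_series P rho y : geometrically_bounded P rho -> `|y| < rho ->
  cvgn (series (fun k => (P k).[y])).
Proof.
move=> HP yr; have [|M HM] := HP `|y|; first by rewrite normr_ge0.
apply: (@is_cvg_series_dominated _ _ M) => k; apply: le_trans (HM k).
by rewrite ler_wpM2r ?exprn_ge0 // ler_abs_horner.
Qed.

Lemma norm_lim_le (u : nat -> R) l M : u @ \oo --> l -> (forall n, `|u n| <= M) -> `|l| <= M.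
Proof.
move=> /cvgrPdist_lt ul uM; apply/ler_addgt0Pr => e /ul[n _ /(_ n (leqnn n)) H].
rewrite -(subrK (u n) l) addrC (le_trans (ler_normD _ _)) // lerD // ltW //.
Qed.

(** Summing the quadratic remainders of the terms gives an error O(h^2) for the whole series, hence
    its derivative. *)
Lemma poly_series_taylor2 P rho y h d M : geometrically_bounded P rho -> 0 < d ->
  `|y| + d < rho -> `|h| <= d ->
  (forall k, abs_horner (P k) (`|y| + d) * 2 ^+ k <= M) ->
  `|poly_series P (y + h) - poly_series P y - h * poly_series (fun k => (P k)^`()) y|
    <= (h / d) ^+ 2 * (2 * M).
Proof.
move=> HP d0 yd hd HM.
have yhr : `|y + h| < rho by rewrite (le_lt_trans (ler_normD _ _)) //; lra.
have yr : `|y| < rho by lra.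
have c1 := is_cvg_poly_series HP yhr; have c2 := is_cvg_poly_series HP yr.
have c3 := is_cvg_poly_series (geometrically_bounded_deriv HP) yr.
have c4 := cvgB (cvgB c1 c2) (cvgMr (a := h) c3).
have {}c4 : (fun n => \sum_(k < n) ((P k).[y + h] - (P k).[y] - h * (P k)^`().[y])) @ \oo -->
    poly_series P (y + h) - poly_series P y - h * poly_series (fun k => (P k)^`()) y.
  rewrite (_ : (fun n => _) = series (fun k => (P k).[y + h]) - series (fun k => (P k).[y])
    - (fun n => h * series (fun k => (P k)^`().[y]) n)); first exact: c4.
  apply/funext => n.
  by rewrite /series /= !fctE !big_mkord !sumrB -mulr_sumr.
apply: (norm_lim_le c4) => n; rewrite (le_trans (ler_norm_sum _ _ _)) //.
have : \sum_(k < n) abs_horner (P k) (`|y| + d) <= 2 * M - 2 * M / 2 ^+ n.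
  exact: (sum_geometric_le (u := fun k => abs_horner (P k) (`|y| + d))).
have yd0 : 0 <= `|y| + d by rewrite addr_ge0 // ltW.
have M0 : 0 <= M by apply: le_trans (HM 0%N); rewrite mulr_ge0 ?exprn_ge0 ?abs_horner_ge0.
have : 0 <= 2 * M / 2 ^+ n by rewrite divr_ge0 ?mulr_ge0 ?exprn_ge0.
move=> h1 h2; have h3 : \sum_(k < n) abs_horner (P k) (`|y| + d) <= 2 * M by lra.
apply: le_trans (ler_wpM2l (sqr_ge0 _) h3); rewrite mulr_sumr ler_sum // => k _.
exact: taylor2_le.
Qed.

Lemma is_derive_poly_series P rho y : geometrically_bounded P rho -> `|y| < rho ->
  is_derive y (1 : R) (poly_series P) (poly_series (fun k => (P k)^`()) y).
Proof.
move=> HP yr; pose d := (rho - `|y|) / 2; have d0 : 0 < d by rewrite /d; lra.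
have [|M HM] := HP (`|y| + d).
  by have := normr_ge0 y; rewrite /d; lra.
have yd0 : 0 <= `|y| + d by rewrite addr_ge0 // ltW.
have M0 : 0 <= M by apply: le_trans (HM 0%N); rewrite mulr_ge0 ?exprn_ge0 ?abs_horner_ge0.
pose D := poly_series (fun k => (P k)^`()) y.
suff H : (fun h : R => h^-1 *: (poly_series P (h *: (1 : R) + y) - poly_series P y)) @ 0^' --> D.
  by split; [exact: (cvgP D)|exact: cvg_lim H].
apply/cvgrPdist_lt => e e0; rewrite /dnbhs /= near_withinE.
(* The added 1 keeps [K] positive when [M = 0]. *)
pose K := 2 * M / d ^+ 2 + 1.
have d2 : 0 < d ^+ 2 by rewrite exprn_gt0.
have Kp : 0 <= 2 * M / d ^+ 2 by rewrite ler_pdivlMr // mul0r mulr_ge0.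
have K0 : 0 < K by rewrite /K; lra.
exists (Num.min d (e / K)) => /=; first by rewrite lt_min d0 divr_gt0.
move=> h /=; rewrite sub0r normrN lt_min => /andP[hd he] h0.
have nh : 0 < `|h| by rewrite normr_gt0.
have H : `|poly_series P (h + y) - poly_series P y - h * D| <= (h / d) ^+ 2 * (2 * M).
  by rewrite (addrC h y); apply: (poly_series_taylor2 HP d0 _ (ltW hd) HM); rewrite /d; lra.
rewrite -[h *: 1]/(h * 1) mulr1 -(ltr_pM2l nh) -normrM.
have -> : h * (D - h^-1 *: (poly_series P (h + y) - poly_series P y)) =
    - (poly_series P (h + y) - poly_series P y - h * D).
  by rewrite mulrBr -[_ *: _]/(_ * _) mulVKf // [RHS]opprB.
rewrite normrN (le_lt_trans H) //.
rewrite expr_div_n -[h ^+ 2]ger0_norm ?sqr_ge0 // normrX expr2 -!mulrA ltr_pM2l //.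
apply: (@le_lt_trans _ _ (`|h| * K)); last by rewrite -ltr_pdivlMr.
by rewrite ler_wpM2l // /K mulrC; lra.
Qed.

End PolynomialSeries.

(** * Iterated radial derivatives *)

Section RadialDerivatives.
Context {R : realType}.
Implicit Types (P : nat -> {poly R}) (g u v : R -> R).

Lemma eq_near_derive1 (f g : R -> R) (r l : R) : (\forall t \near r, f t = g t) ->
  is_derive r (1 : R) g l -> derive1 f r = l.
Proof. by move=> fg [_ gl]; rewrite derive1E (near_eq_derive _ fg). Qed.

Lemma is_derive_poly_series_sqr P sigma (c r : R) : geometrically_bounded P (sigma ^+ 2) ->
  0 < r < sigma -> is_derive r (1 : R) (fun t => c * poly_series P (t ^+ 2))
    (c * (2 * r * poly_series (fun k => (P k)^`()) (r ^+ 2))).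
Proof.
move=> HP hr; have r2 : `|r ^+ 2| < sigma ^+ 2.
  by rewrite ger0_norm ?sqr_ge0 // ltrXn2r ?nnegrE //; lra.
have d1 := is_derive_poly_series HP r2.
have d2 : is_derive r (1 : R) (fun t : R => t ^+ 2) (2 * r).
  by apply: is_derive_eq; rewrite -[_%:A]/(r * 1) mulr1; ring.
have d3 := @is_derive1_comp _ (poly_series P) (fun t => t ^+ 2) r _ _ d1 d2.
have := @is_deriveZ _ _ _ _ c r 1 _ d3; rewrite -[c *: _]/(c * _).
by congr is_derive; ring.
Qed.

(** The induction carries the formula on all of (0, sigma), because differentiating once more
    requires it near [r]. *)
Lemma iter_radial_derive P sigma u j r : geometrically_bounded P (sigma ^+ 2) ->
  (forall r, 0 < r < sigma -> u r = poly_series P (r ^+ 2)) -> 0 < r < sigma ->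
  iter j (fun g r => r^-1 * derive1 g r) u r =
    2 ^+ j * poly_series (fun k => (P k)^`(j)) (r ^+ 2).
Proof.
move=> HP Hu; elim: j r => [|j IH] r hr; first by rewrite /= expr0 mul1r Hu.
rewrite iterS; have HPj := geometrically_bounded_derivn j HP.
rewrite (@eq_near_derive1 _ (fun t => 2 ^+ j * poly_series (fun k => (P k)^`(j)) (t ^+ 2)) r _ _
  (is_derive_poly_series_sqr _ HPj hr)).
  rewrite (exprS 2 j) -[X in _ = _ * poly_series X _]/(fun k => ((P k)^`(j))^`()).
  by field; apply: lt0r_neq0; lra.
have := @near_in_itvoo R 0 sigma r; rewrite in_itv /= => /(_ hr); apply: filterS => t.
by rewrite in_itv /=; apply: IH.
Qed.

(** Dividing r F(r^2) by r leaves F(r^2), whose derivative 2 r F'(r^2) has the original shape. *)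
Lemma iter_radial_derive_odd P sigma v j r : geometrically_bounded P (sigma ^+ 2) ->
  (forall r, 0 < r < sigma -> v r = r * poly_series P (r ^+ 2)) -> 0 < r < sigma ->
  iter j (fun g => derive1 (fun r : R => r^-1 * g r)) v r =
    2 ^+ j * r * poly_series (fun k => (P k)^`(j)) (r ^+ 2).
Proof.
move=> HP Hv; elim: j r => [|j IH] r hr; first by rewrite /= expr0 mul1r Hv.
rewrite iterS; have HPj := geometrically_bounded_derivn j HP.
rewrite (@eq_near_derive1 _ (fun t => 2 ^+ j * poly_series (fun k => (P k)^`(j)) (t ^+ 2)) r _ _
  (is_derive_poly_series_sqr _ HPj hr)).
  by rewrite (exprS 2 j) -[X in _ = _ * poly_series X _]/(fun k => ((P k)^`(j))^`()); ring.
have := @near_in_itvoo R 0 sigma r; rewrite in_itv /= => /(_ hr); apply: filterS => t.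
rewrite in_itv /= => ht; rewrite IH //; field; apply: lt0r_neq0; lra.
Qed.

End RadialDerivatives.

(** * Real and imaginary parts of powers as polynomials in y^2 *)

Section PowerParts.
Context {R : realType}.

(* [(s + i y) ^ k = (re_poly s k).[y ^ 2] + i y (im_poly s k).[y ^ 2]] *)
Definition re_poly (s : R) k : {poly R} :=
  \poly_(i < k.+1) ((-1) ^+ i * s ^+ (k - i.*2) *+ 'C(k, i.*2)).
Definition im_poly (s : R) k : {poly R} :=
  \poly_(i < k.+1) ((-1) ^+ i * s ^+ (k - i.*2.+1) *+ 'C(k, i.*2.+1)).

Lemma coef_re_poly s k i : (re_poly s k)`_i = (-1) ^+ i * s ^+ (k - i.*2) *+ 'C(k, i.*2).
Proof.
rewrite coef_poly; case: ltnP => // ki; rewrite bin_small ?mulr0n //.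
by rewrite (leq_trans ki) // -addnn leq_addr.
Qed.

Lemma coef_im_poly s k i :
  (im_poly s k)`_i = (-1) ^+ i * s ^+ (k - i.*2.+1) *+ 'C(k, i.*2.+1).
Proof.
rewrite coef_poly; case: ltnP => // ki; rewrite bin_small ?mulr0n //.
by rewrite (leq_trans ki) // -addnn leqW // leq_addr.
Qed.

Lemma mulr_exprB_bin (s : R) k j : s * (s ^+ (k - j) *+ 'C(k, j)) = s ^+ (k.+1 - j) *+ 'C(k, j).
Proof.
have [kj|jk] := ltnP k j; first by rewrite bin_small // !mulr0n mulr0.
by rewrite mulrnAr -exprS subSn.
Qed.

Lemma re_poly0 s : re_poly s 0 = 1.
Proof.
apply/polyP => -[|i]; rewrite coef_re_poly coef1 bin0n ?mulr0n //.
by rewrite !expr0 mul1r.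
Qed.

Lemma im_poly0 s : im_poly s 0 = 0.
Proof. by apply/polyP => i; rewrite coef_im_poly coef0 bin0n mulr0n. Qed.

Lemma re_polyS s k : re_poly s k.+1 = s *: re_poly s k - im_poly s k * 'X.
Proof.
apply/polyP => -[|i]; rewrite coefB coefZ coefMX /= !coef_re_poly ?coef_im_poly.
  by rewrite !bin0 !subn0 expr0 !mul1r !mulr1n subr0 exprS.
rewrite doubleS binS mulrnDr subSS exprS !mulN1r -!mulrnAr mulrCA.
by rewrite mulr_exprB_bin subSS [X in _ + X = _]mulNr.
Qed.

Lemma im_polyS s k : im_poly s k.+1 = re_poly s k + s *: im_poly s k.
Proof.
apply/polyP => i; rewrite coefD coefZ !coef_im_poly !coef_re_poly.
by rewrite binS mulrnDr subSS addrC -!mulrnAr mulrCA mulr_exprB_bin subSS.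
Qed.

Lemma expr_complex_parts (s y : R) k :
  (s +i* y) ^+ k = (re_poly s k).[y ^+ 2] +i* (y * (im_poly s k).[y ^+ 2]).
Proof.
elim: k => [|k IH].
  by rewrite re_poly0 im_poly0 expr0 hornerC horner0 mulr0.
rewrite exprS IH re_polyS im_polyS !hornerE; apply/eqP; rewrite eq_complex /=.
by apply/andP; split; apply/eqP; ring.
Qed.

(** With U the first majorant and V the second one times sigma, [re_polyS] and [im_polyS] give U' <=
    |s| U + sigma V and V' <= sigma U + |s| V, so both grow at most by the factor |s| + sigma. *)
Lemma abs_horner_parts (s sigma : R) k : 0 <= sigma ->
  abs_horner (re_poly s k) (sigma ^+ 2) <= (`|s| + sigma) ^+ k /\
  sigma * abs_horner (im_poly s k) (sigma ^+ 2) <= (`|s| + sigma) ^+ k.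
Proof.
move=> s0; have s2 : 0 <= sigma ^+ 2 by rewrite sqr_ge0.
elim: k => [|k [IH1 IH2]].
  by rewrite re_poly0 im_poly0 /abs_horner size_poly1 size_poly0 big_ord_recl
    !big_ord0 coef1 /= normr1 mulr0 !expr0 mulr1 addr0 lexx ler01.
rewrite re_polyS im_polyS (exprS _ k) mulrDl; split.
  rewrite -scaleN1r (le_trans (abs_hornerD _ _ s2)) // lerD //.
    by rewrite (le_trans (abs_hornerZ _ _ s2)) // ler_wpM2l.
  rewrite (le_trans (abs_hornerZ _ _ s2)) // normrN1 mul1r.
  by rewrite (le_trans (abs_hornerMX _ s2)) // expr2 -mulrA ler_wpM2l.
rewrite (le_trans (ler_wpM2l s0 (abs_hornerD _ _ s2))) // mulrDr addrC lerD //.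
  by rewrite (le_trans (ler_wpM2l s0 (abs_hornerZ _ _ s2))) // mulrCA ler_wpM2l.
by rewrite ler_wpM2l.
Qed.

Lemma geometrically_bounded_parts (a : nat -> R) (s r sigma M : R) :
  (forall k, `|a k| * r ^+ k <= M) -> 2 * (`|s| + sigma) <= r -> 0 < sigma ->
  geometrically_bounded (fun k => a k *: re_poly s k) (sigma ^+ 2) /\
  geometrically_bounded (fun k => a k *: im_poly s k) (sigma ^+ 2).
Proof.
move=> aM hr s0.
have bnd k : `|a k| * (`|s| + sigma) ^+ k * 2 ^+ k <= M.
  rewrite (le_trans _ (aM k)) // -mulrA -exprMn ler_wpM2l // mulrC.
  by rewrite lerXn2r ?nnegrE ?mulr_ge0 ?addr_ge0 ?(ltW s0) //; have := normr_ge0 s; lra.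
split=> b /andP[b0 bs]; [exists M|exists (M / sigma)] => k.
  apply: le_trans (bnd k); rewrite ler_wpM2r ?exprn_ge0 //.
  rewrite (le_trans (abs_hornerZ _ _ b0)) // ler_wpM2l //.
  by rewrite (le_trans (abs_horner_le _ b0 (ltW bs))) // (abs_horner_parts s k (ltW s0)).1.
rewrite ler_pdivlMr // (le_trans _ (bnd k)) // mulrAC ler_wpM2r ?exprn_ge0 //.
apply: (@le_trans _ _ (`|a k| * abs_horner (im_poly s k) (sigma ^+ 2) * sigma)).
  rewrite ler_wpM2r ?(ltW s0) // (le_trans (abs_hornerZ _ _ b0)) // ler_wpM2l //.
  by rewrite (abs_horner_le _ b0 (ltW bs)).
by rewrite -mulrA ler_wpM2l // mulrC (abs_horner_parts s k (ltW s0)).2.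
Qed.

End PowerParts.

(** * The Fueter-Sce transform as a series *)

Section FueterSceSeries.
Context {R : realType} {n : nat}.
Let C : numFieldType := R[i].
Implicit Types x : 'rV[R]_n.+1.

Lemma fueter_sce_series (alpha : R) (f : C -> C) (a : nat -> R) x (d r M sigma : R) :
  (forall z : C, normc z < d -> series (fun k => (a k)%:C * z ^+ k) @ \oo --> f z) ->
  (forall k, `|a k| * r ^+ k <= M) ->
  2 * (`|scal x| + sigma) <= r -> `|scal x| + sigma <= d -> 0 < vec_norm x < sigma ->
  let t := vec_norm x ^+ 2 in
  fueter_sce alpha f x = (alpha * 2 ^+ n.-1./2) *:
    ((poly_series (fun k => (a k *: re_poly (scal x) k)^`(n.-1./2)) t)%:A +
     poly_series (fun k => (a k *: im_poly (scal x) k)^`(n.-1./2)) t *: vec x : clifford R n).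
Proof.
move=> fE aM hr hd hx t; have s0 : 0 < sigma by lra.
have [gre gim] := geometrically_bounded_parts aM hr s0.
have fser (y : R) : 0 < y < sigma ->
    series (fun k => (a k)%:C * (scal x +i* y) ^+ k : C) @ \oo --> f (scal x +i* y).
  move=> hy; apply: fE; rewrite (le_lt_trans (normc_ReIm _)) //=.
  by rewrite (gtr0_norm (_ : 0 < y)); lra.
have u_eq (y : R) : 0 < y < sigma -> complex.Re (f (scal x +i* y)) =
    poly_series (fun k => a k *: re_poly (scal x) k) (y ^+ 2).
  move=> /fser/cvg_Re H; rewrite -(cvg_lim (@norm_hausdorff _ R) H).
  congr (limn _); apply/funext => N; rewrite /series /= Re_sum; apply: eq_bigr => k _.
  by rewrite expr_complex_parts hornerZ /= mul0r subr0.
have v_eq (y : R) : 0 < y < sigma -> complex.Im (f (scal x +i* y)) =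
    y * poly_series (fun k => a k *: im_poly (scal x) k) (y ^+ 2).
  move=> hy; have /cvg_Im H := fser y hy; rewrite -(cvg_lim (@norm_hausdorff _ R) H).
  have y2 : `|y ^+ 2| < sigma ^+ 2.
    by rewrite ger0_norm ?sqr_ge0 // ltrXn2r ?nnegrE //; lra.
  rewrite -(cvg_lim (@norm_hausdorff _ R) (cvgMr (a := y) (is_cvg_poly_series gim y2))).
  congr (limn _); apply/funext => N; rewrite /series /= Im_sum mulr_sumr; apply: eq_bigr => k _.
  by rewrite expr_complex_parts hornerZ /= mul0r addr0; ring.
rewrite /fueter_sce (iter_radial_derive _ gre u_eq hx) (iter_radial_derive_odd _ gim v_eq hx) -/t.
rewrite -[RHS]scalerA; congr (_ *: _); rewrite scalerDr /vec_dir !scalerA; congr (_ + _).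
by congr (_ *: _); field; apply: lt0r_neq0; lra.
Qed.

End FueterSceSeries.

(** * Homogeneous polynomials in a scalar and an algebra element *)

Section HomogeneousExpansion.
Context {R : comNzRingType} {A : algType R}.
Implicit Types (p : {poly R}) (s e : R) (v : A).

(* The homogenization of degree [d] of [p], evaluated at the pair [s], [v]. *)
Definition homogeneous_eval d p s v : A := \sum_(j < d.+1) (p`_j * s ^+ (d - j)) *: v ^+ j.

(** With e = 1 and e = -1, this turns products of powers of s + v and s - v into products of powers
    of 1 + X and 1 - X. *)
Lemma homogeneous_eval_mul d p s e v : (size p <= d.+1)%N ->
  homogeneous_eval d.+1 (p * (1 + e *: 'X)) s v = homogeneous_eval d p s v * (s%:A + e *: v).
Proof.
move=> pd; rewrite /homogeneous_eval mulrDr mulr1 -scalerAr.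
have -> : \sum_(j < d.+2) ((p + e *: (p * 'X))`_j * s ^+ (d.+1 - j)) *: v ^+ j =
    \sum_(j < d.+2) (p`_j * s ^+ (d.+1 - j)) *: v ^+ j +
    \sum_(j < d.+2) (e * (p * 'X)`_j * s ^+ (d.+1 - j)) *: v ^+ j.
  by rewrite -big_split; apply: eq_bigr => j _; rewrite coefD coefZ mulrDl scalerDl.
rewrite mulrDr; congr (_ + _).
  rewrite big_ord_recr /= nth_default // mul0r scale0r addr0 mulr_suml.
  apply: eq_bigr => j _; have jd : (j <= d)%N by rewrite -ltnS.
  by rewrite (subSn jd) exprS mulr_algr scalerA; congr (_ *: _); ring.
rewrite big_ord_recl coefMX /= mulr0 mul0r scale0r add0r mulr_suml.
apply: eq_bigr => j _; rewrite /bump ?coefMX add1n /= subSS exprSr -scalerAr -scalerAl scalerA.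
by rewrite mulrA.
Qed.

Lemma size_mul_linear p e : (size (p * (1 + e *: 'X))%R <= (size p).+1)%N.
Proof.
rewrite mulrDr mulr1 -scalerAr (leq_trans (size_polyD _ _)) // geq_max leqnSn /=.
rewrite (leq_trans (size_scale_leq _ _)) // (leq_trans (size_polyMleq _ _)) //.
by rewrite size_polyX addn2.
Qed.

Lemma homogeneous_eval_exp s v k l :
  (size ((1 + 1 *: 'X) ^+ k * (1 + (-1) *: 'X) ^+ l : {poly R})%R <= (k + l).+1)%N /\
  homogeneous_eval (k + l)%N ((1 + 1 *: 'X) ^+ k * (1 + (-1) *: 'X) ^+ l) s v =
    (s%:A + v) ^+ k * (s%:A - v) ^+ l.
Proof.
have ev0 : homogeneous_eval 0 1 s v = 1.
  by rewrite /homogeneous_eval big_ord1 coef1 /= subn0 expr0 mulr1 scale1r expr0.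
have base : (size ((1 + 1 *: 'X) ^+ k : {poly R})%R <= k.+1)%N /\
    homogeneous_eval k ((1 + 1 *: 'X) ^+ k) s v = (s%:A + v) ^+ k.
  elim: k => [|k [IH1 IH2]]; first by rewrite !expr0 size_poly1.
  rewrite !exprSr; split; first by rewrite (leq_trans (size_mul_linear _ _)).
  by rewrite homogeneous_eval_mul // IH2 scale1r.
elim: l => [|l [IH1 IH2]]; first by rewrite addn0 !expr0 !mulr1.
rewrite addnS !exprSr !mulrA; split; first by rewrite (leq_trans (size_mul_linear _ _)).
by rewrite homogeneous_eval_mul // IH2 scaleN1r.
Qed.

Lemma homogeneous_eval_sum I (r : seq I) (F : I -> {poly R}) d s v :
  homogeneous_eval d (\sum_(i <- r) F i) s v = \sum_(i <- r) homogeneous_eval d (F i) s v.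
Proof.
rewrite [RHS]exchange_big /=; apply: eq_bigr => j _.
by rewrite coef_sum mulr_suml scaler_suml.
Qed.

Lemma homogeneous_evalZ (a : R) d p s v :
  homogeneous_eval d (a *: p) s v = a *: homogeneous_eval d p s v.
Proof.
by rewrite scaler_sumr; apply: eq_bigr => j _; rewrite coefZ scalerA mulrA.
Qed.

(** Even powers of [v] are scalars, odd ones multiples of [v]. The sums overshoot the degree: where
    an exponent of [s] is truncated to 0 by an index above [d], the coefficient of [p] is 0. *)
Lemma homogeneous_eval_parity d p s v (t : R) : (size p <= d.+1)%N -> v * v = (- t)%:A ->
  homogeneous_eval d p s v =
    (\sum_(i < d.+1) p`_(i.*2) * (-1) ^+ i * s ^+ (d - i.*2) * t ^+ i)%:A +
    (\sum_(i < d.+1) p`_(i.*2.+1) * (-1) ^+ i * s ^+ (d - i.*2.+1) * t ^+ i) *: v.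
Proof.
move=> pd vv; have v2 i : v ^+ i.*2 = ((- t) ^+ i)%:A.
  elim: i => [|i IH]; first by rewrite !expr0 scale1r.
  by rewrite doubleS !exprS IH mulrA vv mulr_algl scalerA.
have ext M (F : nat -> A) : (forall j, (d < j)%N -> F j = 0) -> (d.+1 <= M)%N ->
    \sum_(j < d.+1) F j = \sum_(j < M) F j.
  move=> F0 dM; rewrite (big_ord_widen _ F dM) [RHS](bigID (fun j : 'I_M => (j < d.+1)%N)) /=.
  by rewrite [X in _ + X]big1 ?addr0 // => j; rewrite -leqNgt; apply: F0.
rewrite /homogeneous_eval (ext (d.+1).*2 (fun j => (p`_j * s ^+ (d - j)) *: v ^+ j)).
- have split2 M (F : nat -> A) : \sum_(j < M.*2) F j = \sum_(i < M) (F i.*2 + F i.*2.+1).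
    elim: M => [|M IH]; first by rewrite !big_ord0.
    by rewrite doubleS !big_ord_recr /= IH addrA.
  rewrite (split2 d.+1 (fun j => (p`_j * s ^+ (d - j)) *: v ^+ j)) big_split !scaler_suml /=.
  congr (_ + _); apply: eq_bigr => i _.
    by rewrite v2 scalerA (exprNn t) -!mulrA (mulrCA (s ^+ _)).
  by rewrite exprS v2 mulr_algr scalerA (exprNn t) -!mulrA (mulrCA (s ^+ _)).
- by move=> j dj; rewrite nth_default ?mul0r ?scale0r // (leq_trans pd).
- by rewrite -addnn leq_addr.
Qed.

End HomogeneousExpansion.

(** * Appell polynomials in powers of the scalar and vector parts *)

Section CliffordVectors.
Context {R : realType} {n : nat}.
Implicit Types (x : 'rV[R]_n.+1) (T : nat -> nat -> R).

Definition vec_normsq x : R := \sum_(i < n) x 0 (lift ord0 i) ^+ 2.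

Lemma vec_norm_sqr x : vec_norm x ^+ 2 = vec_normsq x.
Proof. by rewrite sqr_sqrtr // sumr_ge0 // => i _; rewrite sqr_ge0. Qed.

Lemma vec_mul x : vec x * vec x = (- vec_normsq x)%:A :> clifford R n.
Proof.
have n2 : (2 : R) != 0 by rewrite pnatr_eq0.
(* Doubling symmetrises the double sum, so that anticommutation cancels the pairs of distinct
   generators. *)
apply: (scalerI n2).
have E : vec x * vec x = \sum_(i < n) \sum_(j < n)
    (x 0 (lift ord0 i) * x 0 (lift ord0 j)) *: (gen i * gen j) :> clifford R n.
  rewrite mulr_suml; apply: eq_bigr => i _; rewrite mulr_sumr; apply: eq_bigr => j _.
  by rewrite -scalerAl -scalerAr scalerA.
have E' : vec x * vec x = \sum_(i < n) \sum_(j < n)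
    (x 0 (lift ord0 i) * x 0 (lift ord0 j)) *: (gen j * gen i) :> clifford R n.
  rewrite E exchange_big; apply: eq_bigr => i _; apply: eq_bigr => j _.
  by rewrite [x 0 _ * _]mulrC.
rewrite scaler_nat mulr2n {1}E E' -big_split scalerA /=.
rewrite /vec_normsq -sumrN mulr_sumr scaler_suml.
apply: eq_bigr => i _; rewrite -big_split (bigD1 i) //= big1 ?addr0.
  rewrite -scalerDr gen_anticomm eqxx mulr1 -expr2.
  have -> : - 2 = (- 2 : R) *: (1 : clifford R n) by rewrite scaleNr scaler_nat.
  by rewrite scalerA; congr (_ *: _); ring.
by move=> j /negbTE ji; rewrite -scalerDr gen_anticomm eq_sym ji mulr0 scaler0.
Qed.

Definition appell_coef T k : {poly R} :=
  \sum_(l < k.+1) T k l *: ((1 + 1 *: 'X) ^+ (k - l) * (1 + (-1) *: 'X) ^+ l).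

Lemma size_appell_coef T k : (size (appell_coef T k) <= k.+1)%N.
Proof.
rewrite (leq_trans (size_sum _ _ _)) //; apply/bigmax_leqP => l _.
rewrite (leq_trans (size_scale_leq _ _)) //.
have [+ _] := homogeneous_eval_exp (0 : R) (0 : R^o) (k - l) l.
by rewrite subnK // -ltnS.
Qed.

Lemma appell_poly_homogeneous T k x :
  appell_poly T k x = homogeneous_eval k (appell_coef T k) (scal x) (vec x) :> clifford R n.
Proof.
rewrite homogeneous_eval_sum; apply: eq_bigr => l _; rewrite homogeneous_evalZ.
have [_] := homogeneous_eval_exp (scal x) (vec x : clifford R n) (k - l) l.
have lk : (l <= k)%N by rewrite -ltnS.
by rewrite (subnK lk) => ->.
Qed.

End CliffordVectors.

(** * The Cauchy-Riemann equation on coefficients *)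

Lemma poly_eq0_values (R : numDomainType) (p : {poly R}) : (forall y, p.[y] = 0) -> p = 0.
Proof.
move=> p0; apply: (@roots_geq_poly_eq0 _ _ [seq i%:R | i <- iota 0 (size p)]).
- by apply/allP => y _; rewrite rootE p0.
- by rewrite map_inj_uniq ?iota_uniq // => i j /eqP; rewrite eqr_nat => /eqP.
- by rewrite size_map size_iota.
Qed.

Lemma deriv_sum (R : nzRingType) I (r : seq I) (F : I -> {poly R}) :
  (\sum_(i <- r) F i)^`() = \sum_(i <- r) (F i)^`().
Proof. exact: raddf_sum. Qed.

Section CauchyRiemann.
Context {R : realType} {n : nat}.
Implicit Types (x : 'rV[R]_n.+2) (p q r : {poly R}) (b : clifford R n.+1).

(** Three terms suffice: along a coordinate line through 1 + y e_1, the functions in question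
    combine 1, e_1 and at most one further generator. *)
Lemma partial_clifford_poly (g : 'rV[R]_n.+2 -> clifford R n.+1) i x p q r b1 b2 b3 :
  (forall h, g (h *: delta_mx 0 i + x) = p.[h] *: b1 + q.[h] *: b2 + r.[h] *: b3) ->
  partial_clifford g i x = p^`().[0] *: b1 + q^`().[0] *: b2 + r^`().[0] *: b3.
Proof.
move=> gE; apply: cl_coordP => S; rewrite mk_cliffordE !(cl_coordD, cl_coordZ).
pose P := cl_coord b1 S *: p + cl_coord b2 S *: q + cl_coord b3 S *: r.
have PE h : cl_coord (g (h *: delta_mx 0 i + x)) S = P.[h].
  by rewrite gE !(cl_coordD, cl_coordZ) !hornerE; ring.
have -> : p^`().[0] * cl_coord b1 S + q^`().[0] * cl_coord b2 S + r^`().[0] * cl_coord b3 S =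
    P^`().[0] by rewrite !derivD !derivZ !hornerE; ring.
have [_ <-] := is_derive_poly P 0.
apply: (congr1 (fun u : R -> R => lim (u @ (0 : R)^'))); apply/funext => h /=.
rewrite PE addr0 -[h *: 1]/(h * 1) mulr1.
by have := PE 0; rewrite scale0r add0r => ->.
Qed.

Lemma cl_coordN b S : cl_coord (- b) S = - cl_coord b S.
Proof. by rewrite -scaleN1r cl_coordZ mulN1r. Qed.

Definition row_of (s : R) (w : 'I_n.+1 -> R) : 'rV[R]_n.+2 :=
  \row_j oapp w s (unlift ord0 j).

Lemma row_of0 s w : row_of s w 0 ord0 = s.
Proof. by rewrite mxE unlift_none. Qed.

Lemma row_of_lift s w i : row_of s w 0 (lift ord0 i) = w i.
Proof. by rewrite mxE liftK. Qed.

Lemma vec_row_of s w : vec (row_of s w) = \sum_i w i *: gen i :> clifford R n.+1.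
Proof. by apply: eq_bigr => i _; rewrite row_of_lift. Qed.

Lemma vec_normsq_row_of s w : vec_normsq (row_of s w) = \sum_i w i ^+ 2.
Proof. by apply: eq_bigr => i _; rewrite row_of_lift. Qed.

Lemma row_of_eq x s w : x 0 ord0 = s -> (forall i, x 0 (lift ord0 i) = w i) -> x = row_of s w.
Proof.
move=> x0 xl; apply/rowP => j; case: (unliftP ord0 j) => [i|] ->.
  by rewrite row_of_lift xl.
by rewrite row_of0 x0.
Qed.

Lemma sum_delta_scale (V : lmodType R) (c : R) (i0 : 'I_n.+1) (F : 'I_n.+1 -> V) :
  \sum_i (c * (i == i0)%:R) *: F i = c *: F i0.
Proof.
rewrite (bigD1 i0) //= eqxx mulr1 big1 ?addr0 // => i /negbTE ->.
by rewrite mulr0 scale0r.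
Qed.

Lemma gen_sqr (i : 'I_n.+1) : gen i * gen i = -1 :> clifford R n.+1.
Proof.
have n2 : (2 : R) != 0 by rewrite pnatr_eq0.
apply: (scalerI n2); rewrite !scaler_nat mulr2n gen_anticomm eqxx mulr1.
by rewrite mulNrn.
Qed.

Lemma scalar_gen_eq0 (c d : R) (i : 'I_n.+1) : c%:A + d *: gen i = 0 :> clifford R n.+1 ->
  c = 0 /\ d = 0.
Proof.
move=> E; have s0 : (finset.set0 == finset.set1 i) = false 
  by apply/negbTE; rewrite eq_sym -card_gt0 cards1.
split.
  have := congr1 (cl_coord^~ finset.set0) E; rewrite /= cl_coordD !cl_coordZ cl_coord0.
  by rewrite !blade_coord eqxx s0 mulr1 mulr0 addr0.
have := congr1 (cl_coord^~ (finset.set1 i)) E; rewrite /= cl_coordD !cl_coordZ cl_coord0.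
by rewrite !blade_coord eqxx eq_sym s0 mulr1 mulr0 add0r.
Qed.

Variables (k : nat) (c : {poly R}).
Hypothesis size_c : (size c <= k.+1)%N.

Let g x : clifford R n.+1 := homogeneous_eval k c (scal x) (vec x).

Let a0 i : R := c`_(i.*2) * (-1) ^+ i.
Let b0 i : R := c`_(i.*2.+1) * (-1) ^+ i.

Let gE s w (t : R) : \sum_i w i ^+ 2 = t -> g (row_of s w) =
  (\sum_(i < k.+1) a0 i * s ^+ (k - i.*2) * t ^+ i)%:A +
  (\sum_(i < k.+1) b0 i * s ^+ (k - i.*2.+1) * t ^+ i) *: \sum_i w i *: gen i.
Proof.
move=> <-; rewrite /g (homogeneous_eval_parity _ size_c (vec_mul _)).
by rewrite vec_normsq_row_of vec_row_of /scal row_of0.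
Qed.

(** The equation is read at s = 1, where g = A(t) + B(t) v; [A'] and [B'] are the derivatives in s,
    at s = 1, of the scalar part and of the factor of v. *)
Let A := \poly_(i < k.+1) a0 i.
Let B := \poly_(i < k.+1) b0 i.
Let A' := \poly_(i < k.+1) (a0 i *+ (k - i.*2)).
Let B' := \poly_(i < k.+1) (b0 i *+ (k - i.*2.+1)).

Let gE1 w (t : R) : \sum_i w i ^+ 2 = t ->
  g (row_of 1 w) = (A.[t])%:A + B.[t] *: \sum_i w i *: gen i.
Proof.
move=> wt; rewrite (gE _ wt) !horner_poly; congr (_%:A + _ *: _);
  by apply: eq_bigr => i _; rewrite expr1n mulr1.
Qed.

Let pt (y : R) := row_of 1 (fun i => y * (i == ord0)%:R).

Let sum_sqr_delta (y : R) (i0 : 'I_n.+1) : \sum_i (y * (i == i0)%:R) ^+ 2 = y ^+ 2.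
Proof.
rewrite (bigD1 i0) //= eqxx mulr1 big1 ?addr0 // => i /negbTE ->.
by rewrite mulr0 expr0n.
Qed.

Let partial0 y : partial_clifford g ord0 (pt y) =
  (A'.[y ^+ 2])%:A + (y * B'.[y ^+ 2]) *: gen ord0.
Proof.
pose p := \sum_(i < k.+1) (a0 i * (y ^+ 2) ^+ i) *: ('X + 1%:P) ^+ (k - i.*2).
pose q := y *: \sum_(i < k.+1) (b0 i * (y ^+ 2) ^+ i) *: ('X + 1%:P) ^+ (k - i.*2.+1).
rewrite (@partial_clifford_poly _ _ _ p q 0 1 (gen ord0) 0); last first.
  move=> h; rewrite scaler0 addr0.
  have -> : h *: delta_mx 0 ord0 + pt y = row_of (h + 1) (fun i => y * (i == ord0)%:R).
    apply: row_of_eq => [|i]; rewrite !mxE ?unlift_none ?liftK /= ?eqxx ?mulr1 //.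
    by rewrite mulr0 add0r.
  rewrite (gE _ (sum_sqr_delta y ord0)) sum_delta_scale scalerA /p /q hornerZ !horner_sum.
  congr (_%:A + _ *: _); last rewrite mulrC; last congr (_ * _);
    by apply: eq_bigr => i _; rewrite !hornerE; ring.
rewrite scaler0 addr0 /p /q derivZ hornerZ !deriv_sum !horner_sum !horner_poly.
congr (_%:A + (_ * _) *: _); apply: eq_bigr => i _;
  rewrite derivZ deriv_exp derivD derivX derivC addr0 mul1r hornerZ hornerMn !hornerE;
  by rewrite expr1n mulrnAl mulrnAr mulr1.
Qed.

Let partial1 y : partial_clifford g (lift ord0 ord0) (pt y) =
  (2 * y * A^`().[y ^+ 2])%:A +
  (B.[y ^+ 2] + 2 * y ^+ 2 * B^`().[y ^+ 2]) *: gen ord0.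
Proof.
pose l : {poly R} := 'X + y%:P.
pose p := A \Po (l ^+ 2); pose q := (B \Po (l ^+ 2)) * l.
rewrite (@partial_clifford_poly _ _ _ p q 0 1 (gen ord0) 0); last first.
  move=> h; rewrite scaler0 addr0.
  have -> : h *: delta_mx 0 (lift ord0 ord0) + pt y = row_of 1 (fun i => (h + y) * (i == ord0)%:R).
    apply: row_of_eq => [|i]; rewrite !mxE ?unlift_none ?liftK /= ?mulr0 ?add0r //.
    by rewrite (inj_eq (@lift_inj _ ord0)) mulrDl.
  rewrite (gE1 (sum_sqr_delta _ ord0)) sum_delta_scale scalerA.
  by rewrite /p /q /l !(hornerE, horner_comp).
rewrite scaler0 addr0 /p /q derivM !deriv_comp deriv_exp /l derivD derivX derivC.
congr (_%:A + _ *: _); rewrite !(hornerE, horner_comp) /= ?add0r; ring.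
Qed.

(** In a direction transverse to e_1, t = h^2 + y^2 has derivative 0 at h = 0, so only the variation
    of v contributes. *)
Let partialS y (j : 'I_n) : partial_clifford g (lift ord0 (lift ord0 j)) (pt y) =
  B.[y ^+ 2] *: gen (lift ord0 j).
Proof.
pose l : {poly R} := 'X ^+ 2 + (y ^+ 2)%:P.
pose p := A \Po l; pose q := y *: (B \Po l); pose r := (B \Po l) * 'X.
rewrite (@partial_clifford_poly _ _ _ p q r 1 (gen ord0) (gen (lift ord0 j))); last first.
  move=> h; pose w i := h * (i == lift ord0 j)%:R + y * (i == ord0)%:R.
  have -> : h *: delta_mx 0 (lift ord0 (lift ord0 j)) + pt y = row_of 1 w.
    apply: row_of_eq => [|i]; rewrite !mxE ?unlift_none ?liftK /= ?mulr0 ?add0r //.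
  have w2 : \sum_i w i ^+ 2 = h ^+ 2 + y ^+ 2.
    rewrite -(sum_sqr_delta h (lift ord0 j)) -(sum_sqr_delta y ord0) -big_split.
    apply: eq_bigr => i _; rewrite /w /=; case: (eqVneq i ord0) => [->|_];
      rewrite ?(negbTE (neq_lift _ _)) /= ?mulr0; ring.
  rewrite (gE1 w2) /w; under eq_bigr do rewrite scalerDl.
  rewrite big_split /= !sum_delta_scale scalerDr !scalerA [X in _ + X]addrC addrA.
  by rewrite /p /q /r /l !(hornerE, horner_comp) (mulrC y).
rewrite /p /q /r derivZ derivM !deriv_comp /l derivD derivXn derivC derivX.
rewrite !(hornerE, horner_comp) /= expr0n /= ?(mulr0, add0r, mul0r, mulr0n, scale0r, mulr1).
by rewrite ?(mulr0, add0r, mul0r, mulr0n, scale0r, mulr1, mul0rn).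
Qed.

(** At 1 + y e_1, with t = y^2, the components along 1 and e_1 read A' - (n + 1) B - 2 t dB/dt = 0
    and y (B' + 2 dA/dt) = 0; the conclusion compares coefficients. *)
Lemma cauchy_riemann_coef : (forall x, cauchy_riemann g x = 0) -> forall i,
  c`_(i.*2) *+ (k - i.*2) = c`_(i.*2.+1) *+ (n.+1 + i.*2) /\
  c`_(i.*2.+1) *+ (k - i.*2.+1) = c`_(i.*2.+2) *+ i.*2.+2.
Proof.
move=> CR.
have H y : A'.[y ^+ 2] - n.+1%:R * B.[y ^+ 2] - 2 * y ^+ 2 * B^`().[y ^+ 2] = 0 /\
    y * (B'.[y ^+ 2] + 2 * A^`().[y ^+ 2]) = 0.
  apply: (@scalar_gen_eq0 _ _ ord0); rewrite -(CR (pt y)) /cauchy_riemann.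
  rewrite big_ord_recl partial0 partial1.
  have -> : \sum_(i < n) gen (lift ord0 i) * partial_clifford g (lift ord0 (lift ord0 i)) (pt y) =
      - (n%:R * B.[y ^+ 2])%:A :> clifford R n.+1.
    under eq_bigr => i _ do rewrite partialS -scalerAr gen_sqr scalerN.
    rewrite sumrN sumr_const card_ord; congr (- _).
    by rewrite -scaler_nat scalerA.
  have genM (p q : R) : gen ord0 * (p%:A + q *: gen ord0) = p *: gen ord0 - q%:A
      :> clifford R n.+1.
    by rewrite mulrDr mulr_algr -scalerAr gen_sqr scalerN.
  rewrite genM; set a := A'.[_]; set b := B.[_]; set b' := B^`().[_].
  have -> : a - n.+1%:R * b - 2 * y ^+ 2 * b' = a - (b + 2 * y ^+ 2 * b') - n%:R * b.
    by rewrite -addn1 natrD; ring.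
  have -> : y * (B'.[y ^+ 2] + 2 * A^`().[y ^+ 2]) = y * B'.[y ^+ 2] + 2 * y * A^`().[y ^+ 2].
    by ring.
  by apply: cl_coordP => S; rewrite !(cl_coordD, cl_coordN, cl_coordZ); ring.
have X2 : (1 < size ('X^2 : {poly R}))%N by rewrite size_polyXn.
have E1 : A' - n.+1%:R *: B - 2 *: ('X * B^`()) = 0.
  apply/eqP; rewrite -(comp_poly_eq0 _ X2); apply/eqP/poly_eq0_values => y.
  have [E _] := H y; rewrite horner_comp !hornerE /=.
  by move: E; rewrite expr2 !mulrA.
have E2 : B' + 2 *: A^`() = 0.
  (* The polynomial is multiplied by ['X] to match the factor [y] of the second identity, which says
     nothing at y = 0. *)
  apply/eqP; rewrite -(comp_poly_eq0 _ X2) -[_ == 0]orFb -(polyX_eq0 R) -mulf_eq0.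
  apply/eqP/poly_eq0_values => y.
  by have [_ <-] := H y; rewrite hornerM horner_comp !hornerE.
have cA i : A`_i = a0 i.
  rewrite coef_poly /a0; case: ltnP => // ki; rewrite nth_default ?mul0r //.
  by rewrite (leq_trans size_c) // (leq_trans ki) // -addnn leq_addr.
have cB i : B`_i = b0 i.
  rewrite coef_poly /b0; case: ltnP => // ki; rewrite nth_default ?mul0r //.
  by rewrite (leq_trans size_c) // (leq_trans ki) // -addnn leqW // leq_addr.
have cA' i : A'`_i = a0 i *+ (k - i.*2).
  rewrite coef_poly; case: ltnP => // ki; rewrite (_ : (k - i.*2 = 0)%N) //.
  by apply/eqP; rewrite subn_eq0 (leq_trans (ltnW ki)) // -addnn leq_addr.
have cB' i : B'`_i = b0 i *+ (k - i.*2.+1).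
  rewrite coef_poly; case: ltnP => // ki; rewrite (_ : (k - i.*2.+1 = 0)%N) //.
  by apply/eqP; rewrite subn_eq0 (leq_trans (ltnW ki)) // -addnn leqW // leq_addr.
move=> i; have sgn : (-1) ^+ i != 0 :> R by rewrite signr_eq0.
split; apply: (mulIf sgn).
  have := congr1 (fun p : {poly R} => p`_i) E1.
  rewrite /= !(coefB, coefZ) coefXM cA' cB coef0.
  have -> : (if i == 0%N then 0 else (B^`())`_i.-1) = b0 i *+ i.
    by case: i {sgn} => [|i] /=; rewrite ?mulr0n // coef_deriv cB.
  rewrite /a0 /b0 => /eqP; rewrite subr_eq0 subr_eq => /eqP.
  rewrite !mulrnAl => ->.
  by rewrite !mul1r mulrnDr -muln2 mulrnA addrC.
have := congr1 (fun p : {poly R} => p`_i) E2.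
rewrite /= coefD coefZ coef_deriv cB' cA coef0 /a0 /b0 => /eqP.
rewrite addr_eq0 doubleS exprS mulN1r mulrN mulNrn mulrN opprK !mulrnAl => /eqP ->.
by rewrite -[i.*2.+2]/(i.+1.*2) -muln2 mulrnA ?mulrnAl ?mul1r.
Qed.

End CauchyRiemann.

(** * Closed form of the Appell polynomials *)

Section AppellClosedForm.
Context {R : realType} (m : nat).
Let N := m.*2.
Implicit Types (x : 'rV[R]_N.+2) (T : nat -> nat -> R).

Lemma ffact_addS i : (i.+1 * (i.+1 + m) ^_ m = (i.+1 + m) * (i + m) ^_ m)%N.
Proof. by rewrite addSn -ffactSS ffactnSr subSn ?leq_addl // addnK mulnC. Qed.

Lemma appell_coef0 T k : @appell_family R N.+1 T -> (appell_coef T k)`_0 = 1.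
Proof.
move=> /(_ k)[_ P1 _]; pose x := @row_of R N 1 (fun=> 0).
have vx : vec x = 0 :> clifford R N.+1.
  by rewrite vec_row_of big1 // => i _; rewrite scale0r.
have px : paravector x = 1 :> clifford R N.+1.
  by rewrite /paravector vx addr0 /scal row_of0 scale1r.
have := P1 x px; rewrite appell_poly_homogeneous vx /scal row_of0 /homogeneous_eval.
rewrite big_ord_recl big1 => [|i _]; last by rewrite lift0 expr0n scaler0.
rewrite expr1n mulr1 expr0 addr0 => /eqP; rewrite -subr_eq0 -[X in _ - X]scale1r -scalerBl.
move=> /eqP E; have [] := @scalar_gen_eq0 R N ((appell_coef T k)`_0 - 1) 0 ord0.
  by rewrite E scale0r addr0.
by move=> /eqP; rewrite subr_eq0 => /eqP.
Qed.

(** Both sides obey the two-step recursion of [cauchy_riemann_coef] and agree at index 0.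
    Cross-multiplying keeps the right-hand sides natural numbers; above index [k] the binomials
    vanish. *)
Lemma appell_coefE T k i : @appell_family R N.+1 T ->
  (appell_coef T k)`_(i.*2) * (m`! * 'C(k + N, N))%:R =
    ('C(k + N, i.*2 + N) * (i + m) ^_ m)%:R /\
  (appell_coef T k)`_(i.*2.+1) * (m`! * 'C(k + N, N))%:R =
    ('C(k + N, i.*2.+1 + N) * (i + m) ^_ m)%:R.
Proof.
move=> HT; set c := appell_coef T k; set K := (_ * _)%N.
have rec := @cauchy_riemann_coef R N k c (size_appell_coef T k).
have {}rec j : c`_(j.*2) *+ (k - j.*2) = c`_(j.*2.+1) *+ (N.+1 + j.*2) /\
    c`_(j.*2.+1) *+ (k - j.*2.+1) = c`_(j.*2.+2) *+ j.*2.+2.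
  apply: rec => x; have [hol _ _] := HT k; have [_ <-] := hol x.
  by congr (cauchy_riemann _ x); apply/funext => y; rewrite appell_poly_homogeneous.
have odd_step j : c`_(j.*2) * K%:R = ('C(k + N, j.*2 + N) * (j + m) ^_ m)%:R ->
    c`_(j.*2.+1) * K%:R = ('C(k + N, j.*2.+1 + N) * (j + m) ^_ m)%:R.
  move=> E; have [r1 _] := rec j.
  have nz : (N.+1 + j.*2)%:R != 0 :> R by rewrite pnatr_eq0.
  have r1' : (N.+1 + j.*2)%:R * c`_(j.*2.+1) = (k - j.*2)%:R * c`_(j.*2).
    by rewrite !mulr_natl r1.
  apply: (mulfI nz); rewrite mulrA r1' -mulrA E -!natrM.
  congr _%:R; rewrite !mulnA; congr (_ * _)%N.
  by rewrite addSn (addnC N) mul_bin_left subnDr.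
elim: i => [|i [IH1 IH2]].
  have E0 : c`_(0.*2) * K%:R = ('C(k + N, 0.*2 + N) * (0 + m) ^_ m)%:R.
    by rewrite /c appell_coef0 // mul1r /K double0 !add0n ffactnn mulnC.
  by split; [|apply: odd_step].
suff E : c`_(i.+1.*2) * K%:R = ('C(k + N, i.+1.*2 + N) * (i.+1 + m) ^_ m)%:R.
  by split; [|apply: odd_step].
have [_ r2] := rec i; have nz : i.*2.+2%:R != 0 :> R by rewrite pnatr_eq0.
have r2' : i.*2.+2%:R * c`_(i.*2.+2) = (k - i.*2.+1)%:R * c`_(i.*2.+1).
  by rewrite !mulr_natl r2.
apply: (mulfI nz); rewrite doubleS mulrA r2' -mulrA IH2 -!natrM.
congr _%:R; rewrite mulnA.
have := mul_bin_left (k + N) (i.*2.+1 + N); rewrite subnDr => <-.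
rewrite -[(i.*2.+2 + N)%N]/((i.*2.+1 + N).+1); set X := 'C(_, _).
have -> : ((i.*2.+1 + N).+1 = 2 * (i.+1 + m))%N by rewrite /N; lia.
have -> : (i.*2.+2 = 2 * i.+1)%N by lia.
have -> : (2 * i.+1 * (X * (i.+1 + m) ^_ m) = 2 * X * (i.+1 * (i.+1 + m) ^_ m))%N by ring.
by rewrite ffact_addS; ring.
Qed.

(** The coefficient of index i + m moves to index i, and 2 (i + m) = 2 i + N produces the binomials
    of [appell_coefE]. *)
Lemma horner_re_poly_derivn (s t : R) k :
  ((re_poly s (k + N))^`(m)).[t] = (-1) ^+ m *
    \sum_(i < k.+1) ('C(k + N, i.*2 + N) * (i + m) ^_ m)%:R * (-1) ^+ i * s ^+ (k - i.*2) * t ^+ i.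
Proof.
have cE i : ((re_poly s (k + N))^`(m))`_i =
    (-1) ^+ m * (('C(k + N, i.*2 + N) * (i + m) ^_ m)%:R * (-1) ^+ i * s ^+ (k - i.*2)).
  rewrite coef_derivn coef_re_poly (addnC m) doubleD -/N subnDr exprD -mulrnA.
  by rewrite -[LHS]mulr_natr ?natrM; ring.
rewrite (@horner_coef_wide _ k.+1); last first.
  apply/leq_sizeP => i ki; rewrite cE bin_small ?mul0n ?mul0r ?mulr0 //.
  by rewrite ltn_add2r (leq_trans ki) // -addnn leq_addr.
by rewrite mulr_sumr; apply: eq_bigr => i _; rewrite cE !mulrA.
Qed.

Lemma horner_im_poly_derivn (s t : R) k :
  ((im_poly s (k + N))^`(m)).[t] = (-1) ^+ m *
    \sum_(i < k.+1) ('C(k + N, i.*2.+1 + N) * (i + m) ^_ m)%:R * (-1) ^+ i *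
      s ^+ (k - i.*2.+1) * t ^+ i.
Proof.
have cE i : ((im_poly s (k + N))^`(m))`_i =
    (-1) ^+ m * (('C(k + N, i.*2.+1 + N) * (i + m) ^_ m)%:R * (-1) ^+ i * s ^+ (k - i.*2.+1)).
  rewrite coef_derivn coef_im_poly (addnC m) doubleD -/N -addSn subnDr exprD -mulrnA.
  by rewrite -[LHS]mulr_natr ?natrM; ring.
rewrite (@horner_coef_wide _ k.+1); last first.
  apply/leq_sizeP => i ki; rewrite cE bin_small ?mul0n ?mul0r ?mulr0 //.
  by rewrite ltn_add2r (leq_trans ki) // -addnn leqW // leq_addr.
by rewrite mulr_sumr; apply: eq_bigr => i _; rewrite cE !mulrA.
Qed.

(** The coefficients agree one by one; the constant is the value of the right-hand side at x = 1,
    where P_k is 1. *)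
Lemma appell_poly_closed_form T k x : @appell_family R N.+1 T ->
  ((-1) ^+ m * (m`! * 'C(k + N, N))%:R) *: appell_poly T k x =
    (((re_poly (scal x) (k + N))^`(m)).[vec_normsq x])%:A +
    ((im_poly (scal x) (k + N))^`(m)).[vec_normsq x] *: vec x :> clifford R N.+1.
Proof.
move=> HT; rewrite appell_poly_homogeneous.
rewrite (homogeneous_eval_parity _ (size_appell_coef T k) (vec_mul x)).
rewrite horner_re_poly_derivn horner_im_poly_derivn.
have H (u : nat -> nat) (v : nat -> nat) : (forall i, (appell_coef T k)`_(u i) *
      (m`! * 'C(k + N, N))%:R = ('C(k + N, u i + N) * (i + m) ^_ m)%:R) ->
    (m`! * 'C(k + N, N))%:R * (\sum_(i < k.+1) (appell_coef T k)`_(u i) * (-1) ^+ i *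
      scal x ^+ (v i) * vec_normsq x ^+ i) =
    \sum_(i < k.+1) ('C(k + N, u i + N) * (i + m) ^_ m)%:R * (-1) ^+ i *
      scal x ^+ (v i) * vec_normsq x ^+ i.
  by move=> E; rewrite mulr_sumr; apply: eq_bigr => i _; rewrite -E; ring.
rewrite -(H (fun i => i.*2) (fun i => k - i.*2)%N (fun i => (appell_coefE k i HT).1)).
rewrite -(H (fun i => i.*2.+1) (fun i => k - i.*2.+1)%N (fun i => (appell_coefE k i HT).2)).
by rewrite scalerDr !scalerA !mulrA.
Qed.

End AppellClosedForm.

(** * Uniqueness of power series *)

Section PowerSeriesUniqueness.
Context {R : realType}.
Let C : numFieldType := R[i].

Lemma power_series_coef0 (e : nat -> R) (d : R) : 0 < d ->
  (forall r, 0 < r < d -> series (fun k => e k * r ^+ k) @ \oo --> (0 : R)) -> e 0%N = 0.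
Proof.
move=> d0 H; have hd : 0 < d / 2 < d by lra.
have [M HM] : exists M, forall k, `|e k * (d / 2) ^+ k| <= M.
  have /cvgP/cvg_series_bounded[M [_ HM]] := H _ hd.
  by exists (M + 1) => k; apply: HM => //; rewrite ltrDl ltr01.
(* Terms bounded at d / 2 decay with ratio 1/2 for r <= d / 4, so everything past the constant term
   is at most r K. *)
pose K := 2 * (M / (d / 2)).
have M0 : 0 <= M := le_trans (normr_ge0 _) (HM 0%N).
have K0 : 0 <= K by rewrite mulr_ge0 // divr_ge0 //; lra.
have tail r n : 0 < r <= d / 4 -> `|\sum_(k < n) e k.+1 * r ^+ k.+1| <= r * K.
  move=> hr; under eq_bigr do rewrite exprS mulrCA; rewrite -mulr_sumr normrM.
  rewrite gtr0_norm; last by lra.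
  rewrite ler_wpM2l //; first lra.
  rewrite (le_trans (ler_norm_sum _ _ _)) //.
  have : \sum_(k < n) `|e k.+1 * r ^+ k| <= K - K / 2 ^+ n.
    apply: (@sum_geometric_le _ (fun k => `|e k.+1 * r ^+ k|)) => k.
    rewrite ler_pdivlMr; last by lra.
    apply: le_trans (HM k.+1); rewrite !normrM !normrX (gtr0_norm (_ : 0 < d / 2)); last lra.
    rewrite exprSr [leRHS]mulrA ler_pM2r; last by lra.
    rewrite -mulrA ler_wpM2l // -exprMn lerXn2r ?nnegrE ?mulr_ge0 //; first lra.
    by rewrite gtr0_norm; lra.
  have : 0 <= K / 2 ^+ n by rewrite divr_ge0 ?exprn_ge0.
  lra.
apply/eqP; rewrite -normr_le0; apply/ler_addgt0Pr => eps eps0; rewrite add0r.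
pose r := Num.min (d / 4) (eps / 2 / (K + 1)).
have K1 : 0 < K + 1 by lra.
have r0 : 0 < r by rewrite lt_min; apply/andP; split; [lra|rewrite !divr_gt0].
have r1 : r <= d / 4 by rewrite ge_min lexx.
have r2 : r * K <= eps / 2.
  have : r * (K + 1) <= eps / 2 by rewrite -ler_pdivlMr // ge_min lexx orbT.
  lra.
have hr : 0 < r < d by lra.
have e2 : 0 < eps / 2 by lra.
have /cvgrPdist_lt/(_ _ e2)[n _ Hn] := H r hr.
have := Hn n.+1 (leqnSn n); rewrite /series /= big_mkord big_ord_recl /= expr0 mulr1 sub0r normrN.
have := tail r n; rewrite r0 r1 => /(_ isT); set X := \sum_(k < n) _.
rewrite -[Y in `|_ + Y| < _]/X => h1 h2.
rewrite -(addrK X (e 0%N)) (le_trans (ler_normB _ _)) //; lra.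
Qed.

Lemma power_series_unique (e : nat -> R) (d : R) : 0 < d ->
  (forall r, 0 < r < d -> series (fun k => e k * r ^+ k) @ \oo --> (0 : R)) ->
  forall k, e k = 0.
Proof.
move=> d0 H k; elim: k e H => [|k IH] e H; first exact: (power_series_coef0 d0 H).
apply: (IH (fun k => e k.+1)) => r hr.
have e0 := power_series_coef0 d0 H.
have r0 : r != 0 by rewrite lt0r_neq0 //; lra.
have : (fun n => r^-1 * series (fun k => e k * r ^+ k) n.+1) @ \oo --> r^-1 * 0.
  apply: cvgMr; have /cvgrPdist_lt Hr := H r hr.
  apply/cvgrPdist_lt => eps /Hr[n _ Hn]; exists n => // j nj; apply: Hn; exact: leqW.
rewrite mulr0 (_ : (fun n => _) = series (fun k => e k.+1 * r ^+ k)) //.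
apply/funext => n; rewrite /series /= !big_mkord big_ord_recl e0 mul0r add0r mulr_sumr.
by apply: eq_bigr => i _; rewrite lift0 exprS; field.
Qed.

Lemma taylor_at0_bounded (f : C -> C) (a : nat -> R) :
  taylor_at0 f (fun k => (a k)%:C) -> exists2 d : R, 0 < d &
    (forall z : C, normc z < d -> series (fun k => (a k)%:C * z ^+ k) @ \oo --> f z) /\
    exists M, forall k, `|a k| * (d / 2) ^+ k <= M.
Proof.
move=> /near0_normcP[d d0 H]; exists d => //; split=> //.
have d2 : normc (d / 2)%:C < d by rewrite normc_real gtr0_norm; lra.
have /cvg_Re := H _ d2.
rewrite (_ : (fun n => _) = series (fun k => a k * (d / 2) ^+ k)); last first.
  apply/funext => n; rewrite /series /= Re_sum; apply: eq_bigr => k _.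
  by rewrite -rmorphXn -rmorphM.
move=> /cvgP/cvg_series_bounded[M [_ HM]]; exists (M + 1) => k.
have := HM (M + 1); rewrite ltrDl ltr01 => /(_ isT k I) /=.
by rewrite normrM normrX [`|d / 2|]gtr0_norm //; lra.
Qed.

Lemma taylor_at0_unique (f : C -> C) (a b : nat -> R) :
  taylor_at0 f (fun k => (a k)%:C) -> taylor_at0 f (fun k => (b k)%:C) -> a = b.
Proof.
move=> /taylor_at0_bounded[d d0 [Ha _]] /taylor_at0_bounded[d' d'0 [Hb _]].
apply/funext => k; apply/eqP; rewrite -subr_eq0; apply/eqP.
apply: (@power_series_unique (fun k => a k - b k) (Num.min d d')); first by rewrite lt_min d0.
move=> r /andP[r0]; rewrite lt_min => /andP[rd rd'].
have n1 : normc r%:C < d by rewrite normc_real gtr0_norm.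
have n2 : normc r%:C < d' by rewrite normc_real gtr0_norm.
pose F1 n : R := complex.Re (series (fun k => (a k)%:C * r%:C ^+ k : C) n).
pose F2 n : R := complex.Re (series (fun k => (b k)%:C * r%:C ^+ k : C) n).
have : (fun n => F1 n - F2 n) @ \oo --> (0 : R).
  rewrite -(subrr (complex.Re (f r%:C))).
  by apply: cvgB; [exact: (cvg_Re (Ha _ n1))|exact: (cvg_Re (Hb _ n2))].
have -> : (fun n => F1 n - F2 n) = series (fun k => (a k - b k) * r ^+ k); last by [].
apply/funext => n; rewrite /F1 /F2 /series /= !Re_sum -sumrB; apply: eq_bigr => i _.
by rewrite -!rmorphXn -!rmorphM /= mulrBl.
Qed.

End PowerSeriesUniqueness.

(** * Comparison of the Fueter-Sce and Appell series *)

Section FueterAppell.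
Context {R : realType} (m : nat).
Let N := m.*2.
Let C : numFieldType := R[i].
Implicit Types (x : 'rV[R]_N.+2) (T : nat -> nat -> R) (a : nat -> R).

(** The power of 2 comes from the m radial derivatives, the sign and the factorial from
    [appell_poly_closed_form]. *)
Definition fueter_ratio (alpha : R) : R := alpha * 2 ^+ m * (-1) ^+ m * m`!%:R.

Lemma near0_row_small (sigma : R) : 0 < sigma ->
  \forall x \near (0 : 'rV[R]_N.+2), `|scal x| < sigma /\ vec_norm x < sigma.
Proof.
move=> s0; pose e := sigma / N.+2%:R.
have N2 : 0 < N.+2%:R :> R by rewrite ltr0n.
have e0 : 0 < e by rewrite divr_gt0.
apply/nbhs_ballP; exists e => //= x [_ xe].
have xj j : `|x 0 j| < e by have := xe 0 j; rewrite /ball /= mxE sub0r normrN.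
have es : e <= sigma by rewrite ler_pdivrMr // ler_peMr ?ler1n // ltW.
split; first exact: lt_le_trans (xj _) es.
have h : vec_norm x ^+ 2 <= N.+1%:R * e ^+ 2.
  rewrite vec_norm_sqr /vec_normsq mulr_natl -[X in _ *+ X]card_ord -sumr_const.
  apply: ler_sum => i _; rewrite -[x 0 _ ^+ 2]ger0_norm ?sqr_ge0 // normrX.
  by rewrite lerXn2r ?nnegrE // ltW.
rewrite -(@ltr_pXn2r _ 2) ?nnegrE ?sqrtr_ge0 // ?ltW //; apply: le_lt_trans h _.
have -> : sigma = N.+2%:R * e by rewrite /e mulrC divfK // lt0r_neq0.
rewrite [ltRHS]exprMn ltr_pM2r ?exprn_gt0 // -natrX ltr_nat; lia.
Qed.

Lemma cvg_series_shift (u : nat -> R) (l : R) : (forall k, (k < N)%N -> u k = 0) ->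
  series u @ \oo --> l -> series (fun k => u (k + N)%N) @ \oo --> l.
Proof.
move=> u0 /cvgrPdist_lt H; apply/cvgrPdist_lt => e /H[n0 _ Hn]; exists n0 => // n n0n.
have := Hn (n + N)%N; rewrite /= (leq_trans n0n) ?leq_addr // => /(_ isT).
rewrite /series /= !big_mkord addnC big_split_ord /= big1 ?add0r => [|i _]; last exact: u0.
by under eq_bigr do rewrite addnC.
Qed.

(** Both polynomials have degree at most k / 2 < m; hence the shift of indices by N. *)
Lemma derivn_parts_small (s : R) k : (k < N)%N ->
  (re_poly s k)^`(m) = 0 /\ (im_poly s k)^`(m) = 0.
Proof.
move=> kN; split; apply/polyP => i; rewrite coef_derivn coef0 ?coef_re_poly ?coef_im_poly;
  by rewrite bin_small ?mulr0n ?mul0rn // doubleD -/N -?addnS ltn_addr.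
Qed.

Lemma fueter_sce_appell_series T (f : C -> C) a (alpha : R) : @appell_family R N.+1 T ->
  taylor_at0 f (fun k => (a k)%:C) ->
  \forall x \near (0 : 'rV[R]_N.+2), vec_norm x != 0 -> forall S,
    series (fun k => fueter_ratio alpha * 'C(k + N, N)%:R * a (k + N)%N *
      cl_coord (appell_poly T k x : clifford R N.+1) S) @ \oo -->
    cl_coord (fueter_sce alpha f x : clifford R N.+1) S.
Proof.
move=> HT /taylor_at0_bounded[d d0 [Hf [M HM]]].
(* With |s| and sigma at most d / 8, twice their sum is at most d / 2, the radius at which the
   coefficients are bounded. *)
have s0 : 0 < d / 8 by lra.
apply: filterS (near0_row_small s0) => x [xs xv] xn S.
have vx : 0 < vec_norm x < d / 8 by rewrite lt_neqAle eq_sym xn sqrtr_ge0.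
have h1 : 2 * (`|scal x| + d / 8) <= d / 2 by lra.
have h2 : `|scal x| + d / 8 <= d by lra.
have [gre gim] := geometrically_bounded_parts HM h1 s0.
rewrite (fueter_sce_series alpha Hf HM h1 h2 vx) /= -[N./2]/(m.*2./2) doubleK.
rewrite cl_coordZ cl_coordD !cl_coordZ; set t := vec_norm x ^+ 2.
have tb : `|t| < (d / 8) ^+ 2.
  by rewrite ger0_norm ?sqr_ge0 // ltrXn2r ?nnegrE //; lra.
have c1 := is_cvg_poly_series (geometrically_bounded_derivn m gre) tb.
have c2 := is_cvg_poly_series (geometrically_bounded_derivn m gim) tb.
pose u k := alpha * 2 ^+ m *
  (((a k *: re_poly (scal x) k)^`(m)).[t] * cl_coord (1 : clifford R N.+1) S
  + ((a k *: im_poly (scal x) k)^`(m)).[t] * cl_coord (vec x : clifford R N.+1) S).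
have cu : series u @ \oo --> alpha * 2 ^+ m *
    (poly_series (fun k => (a k *: re_poly (scal x) k)^`(m)) t * cl_coord (1 : clifford R N.+1) S
    + poly_series (fun k => (a k *: im_poly (scal x) k)^`(m)) t *
      cl_coord (vec x : clifford R N.+1) S).
  have -> : series u = (fun n => alpha * 2 ^+ m *
     (series (fun k => ((a k *: re_poly (scal x) k)^`(m)).[t]) n * cl_coord (1 : clifford R N.+1) S
    + series (fun k => ((a k *: im_poly (scal x) k)^`(m)).[t]) n *
      cl_coord (vec x : clifford R N.+1) S)).
    apply/funext => n; rewrite /series /= !mulr_suml -big_split mulr_sumr.
    by apply: eq_bigr.
  by apply: cvgMr; apply: cvgD; apply: cvgMl.
have := cvg_series_shift _ cu; rewrite (_ : (fun k => u (k + N)%N) = (fun k => fueter_ratio alpha *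
  'C(k + N, N)%:R * a (k + N)%N * cl_coord (appell_poly T k x : clifford R N.+1) S)).
  apply=> k /derivn_parts_small H; have [r0 i0] := H (scal x).
  by rewrite /u !derivnZ r0 i0 !scaler0 !horner0 !mul0r addr0 mulr0.
apply/funext => k; have := congr1 (cl_coord^~ S) (appell_poly_closed_form k x HT).
rewrite /= cl_coordD !cl_coordZ -vec_norm_sqr -/t => E.
rewrite /u !derivnZ !hornerZ -!mulrA -mulrDr.
rewrite -E /fueter_ratio natrM; ring.
Qed.

(** A pure vector r e_1: as s = 0, only the top power of v survives in P_k. *)
Definition axis_point (r : R) : 'rV[R]_N.+2 := row_of 0 (fun i => r * (i == ord0)%:R).

Lemma vec_axis_point r : vec (axis_point r) = r *: gen ord0 :> clifford R N.+1.
Proof. by rewrite vec_row_of sum_delta_scale. Qed.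

Lemma appell_poly_axis T k r :
  appell_poly T k (axis_point r) = ((appell_coef T k)`_k * r ^+ k) *: gen ord0 ^+ k
    :> clifford R N.+1.
Proof.
rewrite appell_poly_homogeneous vec_axis_point /scal row_of0 /homogeneous_eval.
rewrite big_ord_recr /= subnn expr0 mulr1 big1 ?add0r => [|j _].
  by rewrite exprZn scalerA.
by rewrite expr0n subn_eq0 leqNgt ltn_ord mulr0 scale0r.
Qed.

Lemma gen_exp (i : 'I_N.+1) k :
  gen i ^+ k = (-1) ^+ k./2 *: (if odd k then gen i else 1) :> clifford R N.+1.
Proof.
elim/ltn_ind: k => -[|[|k]] IH; rewrite ?expr0 ?scale1r //.
rewrite (exprS _ k.+1) (exprS _ k) mulrA gen_sqr (IH k) ?leqnSn //= negbK mulN1r -scaleNr.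
by rewrite exprS mulN1r.
Qed.

Lemma gen_exp_coord (i : 'I_N.+1) k :
  cl_coord (gen i ^+ k : clifford R N.+1) (if odd k then finset.set1 i else finset.set0) =
    (-1) ^+ k./2.
Proof.
by rewrite gen_exp cl_coordZ; case: (odd k); rewrite blade_coord eqxx mulr1.
Qed.

Lemma appell_coef_diag T k : @appell_family R N.+1 T ->
  (appell_coef T k)`_k * (m`! * 'C(k + N, N))%:R = ((k./2 + m) ^_ m)%:R.
Proof.
move=> HT; have [h1 h2] := appell_coefE k k./2 HT.
rewrite -[X in _`_X]odd_double_half; case: (odd k) (odd_double_half k) => /= kE.
  by rewrite add1n h2 -[(k./2.*2.+1)%N]/(1 + k./2.*2)%N kE binn mul1n.
by rewrite add0n h1 -[X in 'C(_, X + _)]add0n kE binn mul1n.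
Qed.

(** Positivity allows cancelling the coefficient, and the bound 1 dominates the Appell series on the
    axis. *)
Lemma appell_coef_diag_bounds T k : @appell_family R N.+1 T ->
  0 < (appell_coef T k)`_k <= 1.
Proof.
move=> /(appell_coef_diag k) E.
have K0 : 0 < (m`! * 'C(k + N, N))%:R :> R.
  by rewrite ltr0n muln_gt0 fact_gt0 bin_gt0 leq_addl.
have -> : (appell_coef T k)`_k = ((k./2 + m) ^_ m)%:R / (m`! * 'C(k + N, N))%:R.
  by rewrite -E mulfK // lt0r_neq0.
rewrite divr_gt0 //=; last by rewrite ltr0n ffact_gt0 leq_addl.
rewrite ler_pdivrMr // mul1r ler_nat -bin_ffact mulnC leq_mul2l; apply/orP; right.
(* With h = [k./2], the square of C(h + m, m) is one term of Vandermonde's sum for C(2 h + 2 m, 2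
   m), and 2 h <= k. *)
apply: (@leq_trans 'C((k./2 + m) + (k./2 + m), m.*2)); last first.
  by rewrite leq_bin2l // /N; have := odd_double_half k; lia.
rewrite -(binomial.Vandermonde (k./2 + m) (k./2 + m) m.*2).
have mm : (m < m.*2.+1)%N by rewrite ltnS -addnn leq_addr.
rewrite (bigD1 (Ordinal mm)) //= (leq_trans _ (leq_addr _ _)) // leq_pmulr // bin_gt0.
by rewrite leq_subLR -addnn leq_add2l leq_addl.
Qed.

Lemma appell_ext_recurrence T (f : C -> C) a (alpha : R) : @appell_family R N.+1 T ->
  taylor_at0 f (fun k => (a k)%:C) ->
  (\forall x \near (0 : 'rV[R]_N.+2), vec_norm x != 0 ->
     fueter_sce alpha f x = appell_ext T a x :> clifford R N.+1) ->
  forall k, fueter_ratio alpha * 'C(k + N, N)%:R * a (k + N)%N = a k.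
Proof.
move=> HT fT near_eq k; have [d d0 [_ [M HM]]] := taylor_at0_bounded fT.
have /nbhs_ballP[e /= e0 He] := near_eq.
have /nbhs_ballP[e' /= e'0 He'] := fueter_sce_appell_series alpha HT fT.
(* The blade that carries e_1^k; the coordinate of e_1^j there is a sign when j has the parity of k,
   and 0 otherwise. *)
pose S : {set 'I_N.+1} := if odd k then finset.set1 ord0 else finset.set0.
pose eps j := cl_coord (gen ord0 ^+ j : clifford R N.+1) S.
have eps_le j : `|eps j| <= 1.
  rewrite /eps gen_exp cl_coordZ normrM normrX normrN1 expr1n mul1r.
  by case: (odd j); rewrite blade_coord normr_nat lern1 leq_b1.
have eps_k : eps k != 0 by rewrite /eps /S gen_exp_coord signr_eq0.
pose del := Num.min (Num.min e e') (d / 4).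
have del0 : 0 < del by rewrite !lt_min e0 e'0; lra.
have [c0 c1] := andP (appell_coef_diag_bounds k HT).
pose D j := (fueter_ratio alpha * 'C(j + N, N)%:R * a (j + N)%N - a j) *
  ((appell_coef T j)`_j * eps j).
suff /(_ k) : forall j, D j = 0.
  move=> /eqP; rewrite mulf_eq0 mulf_eq0 (negbTE eps_k) orbF (gt_eqF c0) orbF subr_eq0.
  by move=> /eqP.
apply: (power_series_unique del0) => r /andP[r0]; rewrite !lt_min => /andP[/andP[re re'] rd].
have vn : vec_norm (axis_point r) != 0.
  rewrite -sqrf_eq0 vec_norm_sqr vec_normsq_row_of (bigD1 ord0) //= ?eqxx mulr1.
  by rewrite paddr_eq0 ?sqr_ge0 ?sumr_ge0 // => [|i _]; rewrite ?sqr_ge0 // sqrf_eq0 gt_eqF.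
have inball (q : R) : 0 < q -> r < q -> ball (0 : 'rV[R]_N.+2) q (axis_point r).
  move=> q0 rq; split=> // i j; rewrite (ord1 i) /ball /= mxE sub0r normrN.
  case: (unliftP ord0 j) => [j'|] ->.
    rewrite row_of_lift normrM gtr0_norm // normr_nat.
    by case: eqP => _; rewrite ?mulr1 ?mulr0.
  by rewrite row_of0 normr0.
have E := He _ (inball e e0 re); have Hc := He' _ (inball e' e'0 re').
have {}Hc := Hc vn S; rewrite (E vn) mk_cliffordE in Hc.
(* [appell_ext] is defined by [limn], which is informative only once the series is known to
   converge. *)
have ca : cvgn (series (fun j => a j *
    cl_coord (appell_poly T j (axis_point r) : clifford R N.+1) S)).
  apply: (@is_cvg_series_dominated _ _ M) => j; rewrite appell_poly_axis cl_coordZ.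
  apply: le_trans (HM j); rewrite !normrM -!mulrA ler_wpM2l //.
  have [cj0 cj1] := andP (appell_coef_diag_bounds j HT).
  rewrite (gtr0_norm cj0) normrX (gtr0_norm r0).
  have p0 : 0 <= r ^+ j * 2 ^+ j by rewrite mulr_ge0 ?exprn_ge0 // ltW.
  apply: (@le_trans _ _ (r ^+ j * 2 ^+ j)).
    have -> : (appell_coef T j)`_j * (r ^+ j * (`|eps j| * 2 ^+ j)) =
      ((appell_coef T j)`_j * `|eps j|) * (r ^+ j * 2 ^+ j) by ring.
    by rewrite ler_piMl // mulr_ile1 // ltW.
  rewrite -exprMn lerXn2r ?nnegrE //; lra.
pose p j := cl_coord (appell_poly T j (axis_point r) : clifford R N.+1) S.
pose F1 := series (fun j => fueter_ratio alpha * 'C(j + N, N)%:R * a (j + N)%N * p j).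
pose F2 := series (fun j => a j * p j).
have : (fun n => F1 n - F2 n) @ \oo --> (0 : R).
  by rewrite -(subrr (limn F2)); apply: cvgB; [exact: Hc|exact: ca].
have -> : (fun n => F1 n - F2 n) = series (fun j => D j * r ^+ j); last by [].
apply/funext => n; rewrite /F1 /F2 /series /= -sumrB; apply: eq_bigr => j _.
by rewrite /p appell_poly_axis cl_coordZ /D -/(eps j); ring.
Qed.

Lemma recurrence_fueter_eq T (f : C -> C) a (alpha : R) : @appell_family R N.+1 T ->
  taylor_at0 f (fun k => (a k)%:C) ->
  (forall k, fueter_ratio alpha * 'C(k + N, N)%:R * a (k + N)%N = a k) ->
  \forall x \near (0 : 'rV[R]_N.+2), vec_norm x != 0 ->
     fueter_sce alpha f x = appell_ext T a x :> clifford R N.+1.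
Proof.
move=> HT fT rec; apply: filterS (fueter_sce_appell_series alpha HT fT) => x Hx xn.
apply: cl_coordP => S; have := Hx xn S; rewrite [RHS]mk_cliffordE.
by under eq_fun do rewrite rec; move=> H; apply/esym; exact: cvg_lim H.
Qed.

End FueterAppell.

(** * From the recurrence to the hypergeometric form *)

Lemma fact_addn_bin (R : realType) N k :
  (k + N)`!%:R = 'C(k + N, N)%:R * (N`!%:R * k`!%:R) :> R.
Proof. by rewrite -!natrM -(bin_fact (leq_addl k N)) addnK. Qed.

Lemma recurrent_coef_eq (R : realType) (a : nat -> R) (g : R) N : (0 < N)%N ->
  (forall k, (k + N)`!%:R * a (k + N)%N = g * k`!%:R * a k) -> a = recurrent_coef a g N.
Proof.
move=> N0 rec; apply/funext; elim/ltn_ind => k IH.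
have [kN|Nk] := ltnP k N; first by rewrite recurrent_coef_lt.
have f0 : k`!%:R != 0 :> R by rewrite pnatr_eq0 -lt0n fact_gt0.
apply: (mulfI f0); have kE : (k - N + N = k)%N by rewrite subnK.
have := rec (k - N)%N; have := recurrent_coefS a g N0 (k - N).
by rewrite kE => -> ->; rewrite -IH // ltn_subrL N0 (leq_trans N0 Nk).
Qed.

Unset Implicit Arguments.

(** The free coefficients form the polynomial part, and each hypergeometric series starts at degree
    n - 1 + r, whence the factor gamma z^(n-1). For gamma = 0, f would be a polynomial of degree
    below n - 1, for which tau_n[f] is 0 while eta_n[f] is 0 only if f is. *)
Theorem theorem4 (R : realType) (n : nat) (n_gt1 : (1 < n)%N) (n_odd : odd n)
    (T : nat -> nat -> R) (T_appell : @appell_family R n T)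
    (f : R[i] -> R[i]) (a : nat -> R)
    (f_entire : entire f) (f_taylor : taylor_at0 f (fun k => (a k)%:C)) :
  (exists alpha : R, \forall x \near (0 : 'rV[R]_n.+1),
     vec_norm x != 0 -> fueter_sce alpha f x = appell_ext T a x)
  <->
  (exists2 gamma : R, gamma != 0 &
     forall z : R[i],
       f z =
       \sum_(r < n.-1) (a r)%:C * z ^+ r +
       gamma%:C * z ^+ n.-1 *
       \sum_(r < n.-1)
         (r`!%:R * a r / (n.-1 + r)`!%:R)%:C * z ^+ r *
         hypergeometric [:: 1]
           [seq (n + r + j)%:R / n.-1%:R | j <- iota 0 n.-1]
           (gamma%:C * z ^+ n.-1 / n.-1%:R ^+ n.-1)).
Proof.
have [m nE] : exists m, n = m.*2.+1.
  by exists n./2; rewrite -{1}(odd_double_half n) n_odd.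
subst n; pose N := m.*2; have N0 : (0 < N)%N by rewrite -ltnS.
have f0 k : k`!%:R != 0 :> R by rewrite pnatr_eq0 -lt0n fact_gt0.
have m0 : 2 ^+ m * (-1) ^+ m * m`!%:R != 0 :> R by rewrite !mulf_neq0 ?signr_eq0 ?expf_neq0.
have c0 k : 'C(k + N, N)%:R != 0 :> R by rewrite pnatr_eq0 -lt0n bin_gt0 leq_addl.
split=> [[alpha near_eq]|[gamma gamma0 fE]].
  have rec := appell_ext_recurrence T_appell f_taylor near_eq.
  pose b := fueter_ratio m alpha.
  have [gamma gamma0 grec] : exists2 gamma : R, gamma != 0 &
      forall k, (k + N)`!%:R * a (k + N)%N = gamma * k`!%:R * a k.
    (* If beta is 0, every a_k is 0 and any nonzero gamma serves. *)
    have [b0|bn0] := eqVneq b 0.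
      exists 1; first exact: oner_neq0.
      have az k : a k = 0 by rewrite -rec -/b b0 !mul0r.
      by move=> k; rewrite !az !mulr0.
    exists (N`!%:R / b) => [|k]; first by rewrite mulf_neq0 ?invr_eq0.
    by rewrite -[a k]rec -/b -/N fact_addn_bin; field.
  exists gamma => // z.
  have aE := recurrent_coef_eq N0 grec.
  have bounded (r : R) : 0 < r -> exists M, forall k, normc (a k)%:C * r ^+ k <= M.
    by move=> r0; rewrite aE; exact: recurrent_coef_bounded.
  have cf := @entire_taylor R f _ f_entire f_taylor bounded z.
  have := @series_recurrent_coef R a gamma N N0 z; rewrite -aE => ch.
  rewrite -(cvg_lim (@norm_hausdorff _ (R[i] : numFieldType)) cf).
  exact: (cvg_lim (@norm_hausdorff _ (R[i] : numFieldType)) ch).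
(* The given form is the sum of the series of [recurrent_coef], so uniqueness of Taylor coefficients
   yields the recurrence. *)
have aE : a = recurrent_coef a gamma N.
  apply: (taylor_at0_unique f_taylor); apply/near0_normcP; exists 1 => // z _.
  by rewrite fE; exact: series_recurrent_coef.
(* Solves [fueter_ratio m alpha] = N! / gamma. *)
pose alpha : R := N`!%:R / gamma / (2 ^+ m * (-1) ^+ m * m`!%:R).
exists alpha; apply: (recurrence_fueter_eq T_appell f_taylor) => k.
have -> : fueter_ratio m alpha = N`!%:R / gamma.
  by rewrite -[RHS](divfK m0) /fueter_ratio !mulrA.
have := recurrent_coefS a gamma N0 k; rewrite -aE fact_addn_bin => E.
by apply: (mulfI (f0 k)); apply: (mulfI gamma0); rewrite [RHS]mulrA -E -/N; field.
Qed.
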